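(* ($H_\infty$ Control) Consider the system $$x(k+1)=A(k)x(k)+B_1(k)v(k)+B_2(k)u(k)+\big(C(k)x(k)+D_1(k)v(k)+D_2(k)u(k)\big)\omega(k),$$ $$z(k)=\overline{C}(k)x(k)+\overline{G}(k)u(k),\quad k\in\mathcal{Q},$$ with $x(0)=x_0=0$, where $u$ is the control input and $v$ the exogenous disturbance. Given $\gamma>0$, there exists a linear feedback control sequence $\{u^*(k),k\in\mathcal{Q}\}$ such that the $H_\infty$ norm $\|\mathbb{L}_{u^*}\|$ of the corresponding closed-loop system satisfies $\|\mathbb{L}_{u^*}\|<\gamma$ if and only if the backward Riccati operator equation $$\begin{aligned}P(k)=&[A(k)+B_2(k)K_2(k,P)]^*P(k+1)[A(k)+B_2(k)K_2(k,P)]\\&+[C(k)+D_2(k)K_2(k,P)]^*P(k+1)[C(k)+D_2(k)K_2(k,P)]\\&+K_2(k,P)^*K_2(k,P)+\overline{C}(k)^*\overline{C}(k)+\mathcal{G}_1(k,-P)^*\mathcal{R}_1(k,-P)^{-1}\mathcal{G}_1(k,-P),\\ \mathcal{R}_1(k,-P)=&\gamma^2I_V-B_1(k)^*P(k+1)B_1(k)-D_1(k)^*P(k+1)D_1(k)>0,\\ \mathcal{R}_2(k,P)=&I_U+B_2(k)^*P(k+1)B_2(k)+D_2(k)^*P(k+1)D_2(k)>0,\quad\forall k\in\mathcal{Q},\\ P(N+1)=&0\end{aligned}$$ admits a solution $P=\{P(k),k\in\mathcal{Q}^+\}$ with $P(k)\in\varepsilon(H)$. And $u^*=\{u^*(k)=K_2(k,P)x(k),\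 k\in\mathcal{Q}\}$ is the $H_\infty$ control, where $P$ is the solution of this equation.
   Context: $H,U,V,Z$ are real separable Hilbert spaces. $L(X,Y)$ is the space of bounded linear operators $X\to Y$, $L(X)=L(X,X)$, $\varepsilon(X)$ is the set of self-adjoint elements of $L(X)$, and $*$ denotes the adjoint. For $T\in L(X)$: $T\ge 0$ means $T$ is self-adjoint and $\langle Tx,x\rangle\ge 0$ for all $x$; $T>0$ means there is $\vartheta>0$ with $T-\vartheta I_X\ge 0$. $\mathcal{Q}=\{0,1,\dots,N\}$, $\mathcal{Q}^+=\{0,1,\dots,N+1\}$. $(\Omega,\mathcal{F},P)$ is a probability space, $\{\omega(k),k\in\mathcal{Q}\}$ is a sequence of real random variables with $E[\omega(k)]=0$ and $E[\omega(k_1)\omega(k_2)]=\delta(k_1,k_2)$ (Kronecker delta). $\mathcal{F}_0=\sigma(x_0)$ (with $x_0$ deterministic) and $\mathcal{F}_k=\sigma(\omega(0),\dots,\omega(k-1))$. For a Hilbert space $K$, $L^2_{K^{\mathcal{Q}}}$ is the space of sequences $q=\{q(k)\}_{k\in\mathcal{Q}}$ of $K$-valued random variables, with $q(k)$ $\mathcal{F}_k$-measurable, and $\|q\|_{L^2_{K^{\mathcal{Q}}}}=(\sum_{k\in\mathcal{Q}}E[\|q(k)\|_K^2])^{1/2}<+\infty$. For $k\in\mathcal{Q}$: $A(k),C(k)\in L(H)$, $B_1(k),D_1(k)\in L(V,H)$, $B_2(k),D_2(k)\in L(U,H)$, $\overline{C}(k)\in L(H,Z)$, $\overline{G}(k)\in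 L(U,Z)$. Standing assumption: $\overline{G}(k)^*\overline{C}(k)=0$ and $\overline{G}(k)^*\overline{G}(k)=I_U$ for all $k\in\mathcal{Q}$. A linear feedback control is $u^*(k)=\overline{K}(k)x(k)$ with $\overline{K}(k)\in L(H,U)$. The corresponding closed-loop system is obtained by substituting $u=u^*$; $\mathbb{L}_{u^*}:L^2_{V^{\mathcal{Q}}}\to L^2_{Z^{\mathcal{Q}}}$ maps $v$ to the closed-loop output $z$ with $x_0=0$, and $\|\mathbb{L}_{u^*}\|=\sup_{v\ne 0}\|\mathbb{L}_{u^*}(v)\|_{L^2_{Z^{\mathcal{Q}}}}/\|v\|_{L^2_{V^{\mathcal{Q}}}}$. In the Riccati equation, the operators are given by $$\mathcal{G}_1(k,-P)=-B_1(k)^*P(k+1)[A(k)+B_2(k)K_2(k,P)]-D_1(k)^*P(k+1)[C(k)+D_2(k)K_2(k,P)],$$ $$\mathcal{G}_2(k,P)=B_2(k)^*P(k+1)[A(k)+B_1(k)K_1(k,-P)]+D_2(k)^*P(k+1)[C(k)+D_1(k)K_1(k,-P)],$$ $$K_1(k,-P)=-\mathcal{R}_1(k,-P)^{-1}\mathcal{G}_1(k,-P),\qquad K_2(k,P)=-\mathcal{R}_2(k,P)^{-1}\mathcal{G}_2(k,P).$$ These four relations are understood as simultaneous equations for $K_1(k,-P)\in L(H,V)$ and $K_2(k,P)\in L(H,U)$; that $P$ is a solution includes the existence of such operators for which all the relations hold.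
   Formalization: The noise is assumed in addition to satisfy E[ω(k)|F_k]=0 and E[ω(k)²|F_k]=1 for all k in Q (implied by independence); with only the unconditional moment conditions the equivalence fails, since the conditional variance of ω(k) may depend on the past. *)

(* Defs.v *)
(* MathComp-Analysis; scalars range over an arbitrary R : realType. *)
From HB Require Import structures.
From mathcomp Require Import all_boot all_order all_algebra.
From mathcomp Require Import all_classical all_reals all_analysis.

Set Implicit Arguments.
Unset Strict Implicit.
Unset Printing Implicit Defensive.

Import Order.TTheory GRing.Theory Num.Theory.
Import numFieldNormedType.Exports.

Local Open Scope classical_set_scope.
Local Open Scope ring_scope.

HB.mixin Record NormedModule_isHilbert (R : realType) H
    & NormedModule R H := {
  inner : {dot H for @idfun R};
  inner_norm : forall x : H, inner x x = `|x| ^+ 2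
}.

#[short(type="hilbertType")]
HB.structure Definition Hilbert (R : realType) :=
  {H of CompleteNormedModule R H & NormedModule_isHilbert R H}.

Definition separable (T : topologicalType) : Prop :=
  exists2 D : set T, countable D & dense D.

(* L(X, Y): for a linear map, continuity is boundedness
   (linear_bounded_continuous). *)
HB.structure Definition BoundedOp (R : realType) (X Y : normedModType R) :=
  {f of @GRing.Linear R X Y *:%R f & @isContinuous X Y f}.

Notation "{ 'bounded' X -> Y }" := (@BoundedOp.type _ X Y)
  (at level 0, X at level 98, Y at level 99,
   format "{ 'bounded'  X  ->  Y }") : type_scope.

Section operators.
Context {R : realType}.
Implicit Types X Y : hilbertType R.

(* For T in L(X, Y) the vector x' exists and is unique (Riesz), so that adj T
   is the Hilbert space adjoint of T; the default 0 is not used. *)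
Definition adj X Y (T : X -> Y) : Y -> X :=
  fun y => xget 0 [set x' | forall x, inner (T x) y = inner x x'].

Definition self_adjoint X (T : X -> X) : Prop := adj T =1 T.

Definition op_ge0 X (T : X -> X) : Prop :=
  self_adjoint T /\ forall x, 0 <= inner (T x) x.

(* Uniform positivity: T - theta I >= 0 for some theta > 0. *)
Definition op_gt0 X (T : X -> X) : Prop :=
  exists2 theta : R, 0 < theta & op_ge0 (T \- (theta \*: idfun)).

(* Only applied to T with op_gt0 T, hence to bijective bounded operators. *)
Definition op_inv X (T : X -> X) : X -> X := pinv setT T.

End operators.

Record plant (R : realType) (H U V Z : hilbertType R) := Plant {
  opA  : nat -> {bounded H -> H};
  opB1 : nat -> {bounded V -> H};
  opB2 : nat -> {bounded U -> H};
  opC  : nat -> {bounded H -> H};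
  opD1 : nat -> {bounded V -> H};
  opD2 : nat -> {bounded U -> H};
  opCbar : nat -> {bounded H -> Z};
  opGbar : nat -> {bounded U -> Z}
}.

Section system.
Context {R : realType} {H U V Z : hilbertType R} (S : plant H U V Z).

Definition next_state (k : nat) (x : H) (v : V) (u : U) (w : R) : H :=
  opA S k x + opB1 S k v + opB2 S k u
  + w *: (opC S k x + opD1 S k v + opD2 S k u).

Definition output (k : nat) (x : H) (u : U) : Z := opCbar S k x + opGbar S k u.

Context {T : Type} (omega : nat -> T -> R) (K : nat -> {bounded H -> U}).

Fixpoint cl_state (v : nat -> T -> V) (k : nat) (t : T) : H :=
  if k is j.+1 then
    let x := cl_state v j t in next_state j x (v j t) (K j x) (omega j t)
  else 0.

Definition cl_output (v : nat -> T -> V) (k : nat) (t : T) : Z :=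
  output k (cl_state v k t) (K k (cl_state v k t)).

End system.

Section probability.
Context {R : realType} {d : measure_display} {T : measurableType d}.
Context (Pr : probability T R) (N : nat).

(* F_k = sigma(omega(0), ..., omega(k-1)); F_0 is the trivial sigma-algebra. *)
Definition history (omega : nat -> T -> R) (k : nat) : set (set T) :=
  g_sigma_preimage (fun i : 'I_k => omega i).

(* Measurability of a K-valued variable with respect to the sigma-algebra F on
   T and the Borel sigma-algebra of K. *)
Definition measurable_wrt (K : topologicalType) (F : set (set T)) (q : T -> K) :=
  preimage_set_system setT q <<s (@open K) >> `<=` F.

Definition orthonormal_noise (omega : nat -> {RV Pr >-> R}) : Prop :=
  (forall k, (k <= N)%N -> ('E_Pr[omega k] = 0)%E) /\
  (forall j k, (j <= N)%N -> (k <= N)%N ->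
     ('E_Pr[fun t => (omega j t * omega k t)%R] = ((j == k)%:R)%:E)%E).

(* E[omega(k) | F_k] = 0 and E[omega(k)^2 | F_k] = 1, written out on the sets
   of F_k.  Under orthonormal_noise this follows from independence of the
   omega(k), but not from orthonormal_noise alone; it is what makes
   E[|omega(k) q|^2] = E[|q|^2] for every F_k-measurable q. *)
Definition nonanticipated_noise (omega : nat -> {RV Pr >-> R}) : Prop :=
  forall k, (k <= N)%N -> forall F, history omega k F ->
    (\int[Pr]_(t in F) (omega k t)%:E = 0 /\
     \int[Pr]_(t in F) (omega k t ^+ 2)%R%:E = Pr F)%E.

Definition L2norm (K : hilbertType R) (q : nat -> T -> K) : \bar R :=
  sqrte (\sum_(k < N.+1) 'E_Pr[fun t => (`|q k t| ^+ 2)%R])%E.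

Definition L2space (K : hilbertType R) (omega : nat -> T -> R) :
    set (nat -> T -> K) :=
  [set q | (forall k, (k <= N)%N -> measurable_wrt (history omega k) (q k)) /\
           (L2norm q < +oo)%E].

(* The norm of the closed-loop operator v |-> z.  The condition v != 0 is read
   in L^2, that is up to almost sure equality.  If V = 0 the supremum is over
   the empty set and equals -oo. *)
Definition Hinf_norm (H U V Z : hilbertType R) (S : plant H U V Z)
    (omega : nat -> T -> R) (K : nat -> {bounded H -> U}) : \bar R :=
  ereal_sup [set (L2norm (cl_output S omega K v) / L2norm v)%E
            | v in L2space omega `&` [set v | L2norm v != 0%E]].

End probability.

Section riccati.
Context {R : realType} {H U V Z : hilbertType R} (S : plant H U V Z).
Context (gamma : R) (N : nat) (P : nat -> {bounded H -> H}).

Definition calR1 (k : nat) : V -> V :=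
  (gamma ^+ 2 \*: idfun) \- (adj (opB1 S k) \o P k.+1 \o opB1 S k)
    \- (adj (opD1 S k) \o P k.+1 \o opD1 S k).

Definition calR2 (k : nat) : U -> U :=
  idfun \+ (adj (opB2 S k) \o P k.+1 \o opB2 S k)
    \+ (adj (opD2 S k) \o P k.+1 \o opD2 S k).

Definition calG1 (K2 : nat -> {bounded H -> U}) (k : nat) : H -> V :=
  (\- (adj (opB1 S k) \o P k.+1 \o (opA S k \+ (opB2 S k \o K2 k))))
    \- (adj (opD1 S k) \o P k.+1 \o (opC S k \+ (opD2 S k \o K2 k))).

Definition calG2 (K1 : nat -> {bounded H -> V}) (k : nat) : H -> U :=
  (adj (opB2 S k) \o P k.+1 \o (opA S k \+ (opB1 S k \o K1 k)))
    \+ (adj (opD2 S k) \o P k.+1 \o (opC S k \+ (opD1 S k \o K1 k))).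

Definition riccati_rhs (K2 : nat -> {bounded H -> U}) (k : nat) : H -> H :=
  let AK := opA S k \+ (opB2 S k \o K2 k) in
  let CK := opC S k \+ (opD2 S k \o K2 k) in
  (adj AK \o P k.+1 \o AK) \+ (adj CK \o P k.+1 \o CK)
    \+ (adj (K2 k) \o K2 k) \+ (adj (opCbar S k) \o opCbar S k)
    \+ (adj (calG1 K2 k) \o op_inv (calR1 k) \o calG1 K2 k).

(* P is a solution of the backward Riccati equation, with K1 and K2 operators
   satisfying the coupled relations that define K_1(k,-P) and K_2(k,P). *)
Definition riccati_solution (K1 : nat -> {bounded H -> V})
    (K2 : nat -> {bounded H -> U}) : Prop :=
  [/\ forall k, (k <= N.+1)%N -> self_adjoint (P k),
      P N.+1 =1 (fun=> 0)
    & forall k, (k <= N)%N ->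
        [/\ K1 k =1 \- (op_inv (calR1 k) \o calG1 K2 k),
            K2 k =1 \- (op_inv (calR2 k) \o calG2 K1 k),
            op_gt0 (calR1 k), op_gt0 (calR2 k)
          & P k =1 riccati_rhs K2 k]].

End riccati.

(* Main.v *)
Require Import Defs.
From HB Require Import structures.
From mathcomp Require Import all_boot all_order all_algebra.
From mathcomp Require Import all_classical all_reals all_analysis.
From mathcomp Require Import measurable_realfun ring lra.
Import Order.TTheory GRing.Theory Num.Theory.
Import numFieldNormedType.Exports.
Local Open Scope classical_set_scope.
Local Open Scope ring_scope.

(** The system is a zero-sum quadratic game: the control u wants the payoff
    |z|^2 - gamma^2 |v|^2, summed over time and averaged, to be small, and the
    disturbance v wants it to be large. A gain below gamma means that the
    payoff is at most -eps |v|^2, and the Riccati equation is the backward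
    dynamic programming equation of the game, with value <P(k) x, x>.

    Only two conditional moments of the noise matter: given the past it has
    mean 0 and variance 1, so the quadratic energy of drift + omega * diffusion
    is the sum of the energies of drift and diffusion (noise_energy). Thus each
    stage reduces to a deterministic quadratic function of (x, v, u)
    (stage_payoff), whose stationary point in (v, u) is (K1 x, K2 x) and whose
    value there is <P(k) x, x>. It is concave in v with second-order part -R1
    (payoff_disturbance) and convex in u with second-order part R2
    (payoff_control). The values telescope along trajectories (total_payoff).

    Suppose that P solves the equation, and let u = K2 x. The total payoff is
    then -sum E <R1 h, h> with h = v - K1 x, hence at most -theta |h|^2. The map
    from h to v is bounded, because x obeys a linear recursion driven by h
    (disturbance_le_deviation); so the payoff is at most -eps |v|^2 and the
    norm is strictly below gamma (riccati_gain_lt, Hinf_norm_lt).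

    Conversely, let some feedback K have gain below gamma. The solution is
    built backwards, keeping P(k) >= 0. The one thing to prove at time k is
    R1(k) > 0. Let v be 0 before time k, equal to a constant v0 at time k, and
    equal to K1 x later, where K1 is already known. As (K1 x, K2 x) is a saddle
    point, against K1 x no control, in particular not K x, brings the payoff
    below -<R1(k) v0, v0>; it is at most -eps |v0|^2, so R1(k) >= eps
    (coercive_calR1). Then R2(k) >= 1 because P(k+1) >= 0; eliminating one gain
    leaves an invertible equation for the other (saddle_gains_exist), and the
    new value is nonnegative by comparison with v = 0 (riccati_step).

    Adjoints and inverses of positive operators both come from minimizing a
    coercive quadratic functional on a Hilbert space (lax_milgram).
    Separability makes sums and inner products of random vectors measurable
    (measurable_wrt_pair). *)

Set Implicit Arguments.
Unset Strict Implicit.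
Unset Printing Implicit Defensive.

Local Notation "''[' x , y ]" := (inner x y) : ring_scope.

(** * Hilbert spaces and bounded operators *)

Section inner_product.
Context {R : realType} {X : hilbertType R}.
Implicit Types x y z : X.

Lemma innerC x y : '[x, y] = '[y, x].
Proof. by rewrite (hermC inner) expr0 mul1r. Qed.
Lemma innerDl x y z : '[x + y, z] = '[x, z] + '[y, z].
Proof. exact: linearDl. Qed.
Lemma innerDr x y z : '[z, x + y] = '[z, x] + '[z, y].
Proof. exact: linearDr. Qed.
Lemma innerZl a x y : '[a *: x, y] = a * '[x, y].
Proof. exact: linearZl_LR. Qed.
Lemma innerZr a x y : '[x, a *: y] = a * '[x, y].
Proof. by rewrite innerC innerZl innerC. Qed.
Lemma innerNl x y : '[- x, y] = - '[x, y].
Proof. exact: linearNl. Qed.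
Lemma innerNr x y : '[x, - y] = - '[x, y].
Proof. exact: linearNr. Qed.
Lemma inner0l x : '[0, x] = 0. Proof. exact: linear0l. Qed.
Lemma inner0r x : '[x, 0] = 0. Proof. exact: linear0r. Qed.

Definition innerE :=
  (innerDl, innerDr, innerNl, innerNr, innerZl, innerZr, inner0l, inner0r).

Lemma inner_ge0 x : 0 <= '[x, x].
Proof. by rewrite inner_norm exprn_ge0. Qed.

Lemma inner_eq0 x : '[x, x] = 0 -> x = 0.
Proof. by rewrite inner_norm => /eqP; rewrite sqrf_eq0 normr_eq0 => /eqP. Qed.

Lemma inner_inj x y : (forall z, '[z, x] = '[z, y]) -> x = y.
Proof.
move=> xy; apply/eqP; rewrite -subr_eq0; apply/eqP/inner_eq0.
by rewrite innerDr innerNr xy subrr.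
Qed.

Lemma cauchy_schwarz x y : `|'[x, y]| <= `|x| * `|y|.
Proof.
rewrite -(@ler_pXn2r _ 2)// ?nnegrE ?mulr_ge0// real_normK ?num_real// exprMn.
rewrite -!inner_norm.
have [->|y0] := eqVneq y 0; first by rewrite !inner0r expr0n mulr0.
have yy : 0 < '[y, y] by rewrite inner_norm exprn_gt0// normr_gt0.
have := inner_ge0 ('[y, y] *: x - '[x, y] *: y).
rewrite !innerE (innerC y x) => h.
rewrite -subr_ge0 -(pmulr_rge0 _ yy).
by apply: le_trans h _; rewrite le_eqVlt; apply/orP; left; apply/eqP; ring.
Qed.

Lemma inner_le x y : '[x, y] <= `|x| * `|y|.
Proof. exact: le_trans (ler_norm _) (cauchy_schwarz x y). Qed.

End inner_product.

Section bounded_operators.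
Context {R : realType}.

(** Boundedness by an explicit constant: unlike the packed type of bounded
    operators it applies to composites written with plain functions. *)
Definition bounded_op {X Y : normedModType R} (f : X -> Y) : Prop :=
  linear f /\ exists2 M : R, 0 <= M & forall x, `|f x| <= M * `|x|.

Lemma bounded_opP {X Y : normedModType R} (f : {bounded X -> Y}) :
  bounded_op f.
Proof.
split; first exact: linearP.
have /linear_bounded_continuous/linear_boundedP[M [_ hM]] :
  continuous f by exact: cts_fun.
exists (Num.max 0 M + 1); first by rewrite addr_ge0// le_max lexx.
by apply: hM; rewrite ltr_pwDr// le_max lexx orbT.
Qed.

(** The bridge from operators assembled by composition to the packed type over
    which the solutions of the Riccati equation range. *)
Lemma bounded_op_pack {X Y : normedModType R} (f : X -> Y) :
  bounded_op f -> exists g : {bounded X -> Y}, g = f :> (X -> Y).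
Proof.
move=> [lf [M M0 hM]].
pose lin := GRing.isLinear.Build R X Y *:%R f lf.
pose F : {linear X -> Y} := HB.pack f lin.
have cf : continuous f.
  apply: (linear_bounded_continuous F).1; apply/linear_boundedP.
  exists M; split=> [|r Mr x]; first exact: num_real.
  by apply: le_trans (hM x) _; rewrite ler_wpM2r// ltW.
pose cont := isContinuous.Build X Y f cf.
pose G : {bounded X -> Y} := HB.pack f lin cont.
by exists G.
Qed.

Section linear_map.
Context {X Y : normedModType R} {f : X -> Y} (bf : bounded_op f).
Lemma bop_P a x y : f (a *: x + y) = a *: f x + f y. Proof. exact: bf.1. Qed.
Lemma bop_D x y : f (x + y) = f x + f y.
Proof. by have := bop_P 1 x y; rewrite !scale1r. Qed.
Lemma bop_0 : f 0 = 0.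
Proof.
by have /esym/eqP := bop_D 0 0; rewrite addr0 -subr_eq0 addrK => /eqP.
Qed.
Lemma bop_Z a x : f (a *: x) = a *: f x.
Proof. by rewrite -[a *: x]addr0 bop_P bop_0 addr0. Qed.
Lemma bop_N x : f (- x) = - f x.
Proof. by rewrite -scaleN1r bop_Z scaleN1r. Qed.
Lemma bop_B x y : f (x - y) = f x - f y. Proof. by rewrite bop_D bop_N. Qed.
End linear_map.

Lemma bounded_op_comp {X Y Z : normedModType R} (g : Y -> Z) (f : X -> Y) :
  bounded_op g -> bounded_op f -> bounded_op (g \o f).
Proof.
move=> [lg [M M0 hM]] [lf [L L0 hL]]; split=> [a x y /=|].
  by rewrite lf lg.
exists (M * L) => [|x /=]; first exact: mulr_ge0.
by apply: le_trans (hM _) _; rewrite -mulrA ler_wpM2l.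
Qed.

Lemma bounded_opD {X Y : normedModType R} (g f : X -> Y) :
  bounded_op g -> bounded_op f -> bounded_op (g \+ f).
Proof.
move=> [lg [M M0 hM]] [lf [L L0 hL]]; split=> [a x y /=|].
  by rewrite lf lg scalerDr addrACA.
exists (M + L) => [|x /=]; first exact: addr_ge0.
by apply: le_trans (ler_normD _ _) _; rewrite mulrDl lerD.
Qed.

Lemma bounded_opN {X Y : normedModType R} (f : X -> Y) :
  bounded_op f -> bounded_op (\- f).
Proof.
move=> [lf [L L0 hL]]; split=> [a x y /=|]; first by rewrite lf opprD scalerN.
by exists L => // x; rewrite normrN.
Qed.

Lemma bounded_opB {X Y : normedModType R} (g f : X -> Y) :
  bounded_op g -> bounded_op f -> bounded_op (g \- f).
Proof.
move=> bg bf; have -> : g \- f = g \+ (\- f) by exact/funext.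
exact: bounded_opD bg (bounded_opN bf).
Qed.

Lemma bounded_opZ {X Y : normedModType R} a (f : X -> Y) :
  bounded_op f -> bounded_op (a \*: f).
Proof.
move=> [lf [L L0 hL]]; split=> [b x y /=|].
  by rewrite lf scalerDr !scalerA mulrC.
exists (`|a| * L) => [|x]; first exact: mulr_ge0.
by rewrite normrZ -mulrA ler_wpM2l.
Qed.

Lemma bounded_op_id {X : normedModType R} : bounded_op (@idfun X).
Proof. by split=> //; exists 1 => // x; rewrite mul1r. Qed.

Lemma bounded_op_cst0 {X Y : normedModType R} :
  bounded_op (fun _ : X => 0 : Y).
Proof.
split=> [a x y|]; first by rewrite scaler0 addr0.
by exists 0 => // x; rewrite normr0 mul0r.
Qed.

End bounded_operators.

Section riesz.
Context {R : realType} {X : hilbertType R}.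
Implicit Types T : X -> X.

Definition symmetric_op T := forall x y, '[T x, y] = '[x, T y].

(** The energy functional <Tx, x> - 2 f(x) of a coercive symmetric operator
    attains its minimum: by the parallelogram identity every minimizing
    sequence is Cauchy.  Stationarity at the minimum is <Tx, .> = f.  For T = 1
    this is the Riesz representation theorem, and for f = <., b> it solves
    T x = b. *)
Lemma lax_milgram T (theta : R) (f : X -> R) :
  bounded_op T -> symmetric_op T -> 0 < theta ->
  (forall x, theta * `|x| ^+ 2 <= '[T x, x]) ->
  scalar f -> (exists M, forall x, `|f x| <= M * `|x|) ->
  exists x, forall y, '[T x, y] = f y.
Proof.
move=> bT sT th0 cT lf [M0 hM0].
pose M := `|M0|.
have hM x : `|f x| <= M * `|x|.
  by apply: le_trans (hM0 x) _; rewrite ler_wpM2r// ler_norm.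
have fP a x y : f (a *: x + y) = a * f x + f y by exact: lf.
have f0 : f 0 = 0.
  have := fP 1 0 0; rewrite scaler0 addr0 mul1r => /esym/eqP.
  by rewrite -subr_eq0 addrK => /eqP.
have fZ a x : f (a *: x) = a * f x by rewrite -[a *: x]addr0 fP f0 addr0.
have fD x y : f (x + y) = f x + f y by have := fP 1 x y; rewrite !scale1r mul1r.
have Tge0 x : 0 <= '[T x, x].
  by apply: le_trans (cT x); rewrite mulr_ge0 ?exprn_ge0// ltW.
pose J x := '[T x, x] - 2 * f x.
have JD x y t : J (x + t *: y) =
    J x + 2 * t * ('[T x, y] - f y) + t ^+ 2 * '[T y, y].
  rewrite /J (bop_D bT) (bop_Z bT) fD fZ !innerE.
  by rewrite (sT y x) (innerC y (T x)); ring.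
(* Young's inequality for M |x|, absorbed by the coercivity of T. *)
have Jlb x : - (M ^+ 2 / theta) <= J x.
  rewrite -subr_ge0 -(pmulr_rge0 _ th0).
  have h1 := cT x; have := ler_normlP _ _ (hM x) => -[_ h2].
  have := sqr_ge0 (theta * `|x| - M) => h3.
  have h4 : theta * (theta * `|x| ^+ 2) <= theta * '[T x, x].
    by rewrite ler_wpM2l// ltW.
  have h5 : theta * f x <= theta * (M * `|x|) by rewrite ler_wpM2l// ltW.
  have h6 : theta * (M ^+ 2 / theta) = M ^+ 2 by field; rewrite gt_eqF.
  by rewrite /J opprK mulrDr mulrBr h6; move: h3 h4 h5; lra.
pose m := inf (range J).
have hasJ : has_inf (range J).
  split; first by exists (J 0), 0.
  by exists (- (M ^+ 2 / theta)) => _ [x _ <-].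
have mJ x : m <= J x by apply: ge_inf; [exact: hasJ.2|exists x].
have /choice[u hu] (n : nat) : exists x, J x < m + n.+1%:R^-1.
  have [|_ [x _ <-] ?] := @inf_adherent _ (range J) n.+1%:R^-1 _ hasJ.
    by rewrite invr_gt0.
  by exists x.
(* The parallelogram identity: the midpoint of u n and u k is a competitor. *)
have uC n k : theta * `|u n - u k| ^+ 2 <= 2 * (n.+1%:R^-1 + k.+1%:R^-1).
  apply: le_trans (cT _) _.
  have := mJ (u k + 2^-1 *: (u n - u k)).
  have := JD (u k) (u n - u k) 1; rewrite scale1r subrKC.
  rewrite JD; move: (hu n) (hu k).
  set a := '[_, _] - _; set q := '[_, _]; set c := _^-1; set d := _^-1.
  move=> ha hb hc hd; lra.
have [x hx] : exists x, forall e, 0 < e -> exists n,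
    `|x - u n| < e /\ n.+1%:R^-1 < e.
  have /cauchy_cvg/cvg_ex[x ux] : cauchy (u @ \oo).
    apply: cauchy_exP => e e0.
    have e1 : 0 < theta * e ^+ 2 / 4.
      by rewrite divr_gt0// mulr_gt0// exprn_gt0.
    have [n _ hn] : \forall n \near \oo, n.+1%:R^-1 < theta * e ^+ 2 / 4.
      exact: near_infty_natSinv_lt (PosNum e1).
    exists (u n); exists n => // k /= nk; rewrite -ball_normE/=.
    rewrite -(@ltr_pXn2r _ 2)// ?nnegrE// ?(ltW e0)//.
    rewrite -(ltr_pM2l th0); apply: le_lt_trans (uC _ _) _.
    have := hn _ (leqnn n); have := hn _ nk => /=.
    by set a := n.+1%:R^-1; set b := k.+1%:R^-1; lra.
  exists x => e e0.
  move/cvgrPdist_lt : ux => /(_ _ e0) h1.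
  have h2 := near_infty_natSinv_lt (PosNum e0).
  have [n _ /(_ n (leqnn n)) [? ?]] := filterI h1 h2.
  by exists n.
(* Expand J around the limit x and evaluate at u n. *)
have Jx : J x <= m.
  apply/ler_addgt0Pr => e e0.
  pose c := 2 * (`|T x| + M) + 1.
  have b0 : 0 <= `|T x| + M by apply: addr_ge0; exact: normr_ge0.
  have c0 : 0 < c by rewrite /c; lra.
  have c1 : 0 < c + 1 by rewrite addr_gt0.
  have [|n [xn ne]] := hx (e / (c + 1)); first exact: divr_gt0.
  have := JD x (x - u n) (-1); rewrite scaleN1r opprB subrKC => hJ.
  have h1 := Tge0 (x - u n).
  have h2 := inner_le (T x) (x - u n).
  have := ler_normlP _ _ (hM (x - u n)) => -[h3 _].
  have h4 : (c + 1) * (e / (c + 1)) = e by field; rewrite gt_eqF.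
  have h5 : (2 * (`|T x| + M)) * `|x - u n| <=
      (2 * (`|T x| + M)) * (e / (c + 1)).
    by rewrite ler_wpM2l ?(ltW xn)// mulr_ge0.
  have := hu n; move: h2 h3 h4 h5 hJ ne; rewrite /c.
  have ep : 0 < e / (c + 1) by exact: divr_gt0.
  move: ep; rewrite /c; set e' := e / _; set w := `|x - u n|.
  by set n' := n.+1%:R^-1; move: h1; set q := '[_, x - u n]; clearbody M; lra.
exists x => y.
pose q := '[T y, y]; pose L := '[T x, y] - f y.
suff : L = 0 by move/eqP; rewrite subr_eq0 => /eqP.
have q0 : 0 <= q := Tge0 y.
have q1 : q + 1 != 0 by rewrite gt_eqF// ltr_wpDl.
(* The competitor x - (L / (q + 1)) y would lower J unless L = 0. *)
have := le_trans Jx (mJ (x + (- (L / (q + 1))) *: y)).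
rewrite JD -/L -/q -addrA lerDl.
have -> : 2 * - (L / (q + 1)) * L + (- (L / (q + 1))) ^+ 2 * q =
   - ((L / (q + 1)) ^+ 2 * (q + 2)) by field.
rewrite oppr_ge0 pmulr_lle0 ?ltr_wpDl// => h.
have /eqP : (L / (q + 1)) ^+ 2 = 0 by apply/le_anti; rewrite h sqr_ge0.
by rewrite sqrf_eq0 mulf_eq0 invr_eq0 (negbTE q1) orbF => /eqP.
Qed.

End riesz.

Section adjoint.
Context {R : realType} {X Y : hilbertType R} {T : X -> Y} (bT : bounded_op T).

Lemma adjP x y : '[T x, y] = '[x, adj T y].
Proof.
have [x' hx'] : exists x', forall z, '[idfun x', z] = '[T z, y].
  apply: (@lax_milgram _ _ idfun 1) => // [|z|a z w|].
  - exact: bounded_op_id.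
  - by rewrite mul1r inner_norm.
  - by rewrite (bop_P bT) !innerE.
  have [_ [M M0 hM]] := bT; exists (M * `|y|) => z.
  by apply: le_trans (cauchy_schwarz _ _) _; rewrite mulrAC ler_wpM2r.
have : [set x' | forall z, '[T z, y] = '[z, x']] (adj T y).
  by apply: xgetPex; exists x' => z; rewrite -hx' innerC.
exact.
Qed.

Lemma adj_unique y x' : (forall x, '[T x, y] = '[x, x']) -> adj T y = x'.
Proof. by move=> h; apply: inner_inj => z; rewrite -adjP h. Qed.

Lemma bounded_op_adj : bounded_op (adj T).
Proof.
split=> [a x y|]; first by apply: adj_unique => z; rewrite !innerE !adjP.
have [_ [M M0 hM]] := bT; exists M => // y.
have [->|h] := eqVneq (adj T y) 0; first by rewrite normr0 mulr_ge0.
rewrite -(@ler_pM2r _ `|adj T y|) ?normr_gt0// -expr2 -inner_norm -adjP.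
by apply: le_trans (inner_le _ _) _; rewrite mulrAC ler_wpM2r.
Qed.

End adjoint.

Section positive_operators.
Context {R : realType} {X : hilbertType R} {T : X -> X} (bT : bounded_op T).

Lemma self_adjointP : self_adjoint T <-> symmetric_op T.
Proof.
split=> [sT x y|sT x]; first by rewrite (adjP bT) sT.
by apply: (adj_unique bT) => y; exact: sT.
Qed.

End positive_operators.

Section coercive_operators.
Context {R : realType} {X : hilbertType R}.
Implicit Types T : X -> X.

Definition coercive (theta : R) T := forall x, theta * `|x| ^+ 2 <= '[T x, x].

(** Uniform positivity without adjoints, as the estimates use it. *)
Lemma op_gt0P T : bounded_op T ->
  op_gt0 T <-> symmetric_op T /\ exists2 theta, 0 < theta & coercive theta T.
Proof.
move=> bT.
have bB theta : bounded_op (T \- (theta \*: idfun)).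
  by apply: bounded_opB => //; apply: bounded_opZ; exact: bounded_op_id.
split=> [[theta th0 [/(self_adjointP (bB theta)) sT pT]]|[sT [theta th0 pT]]].
  split=> [x y|].
    by have := sT x y; rewrite /= !innerE => /addIr.
  exists theta => // x.
  by have := pT x; rewrite /= !innerE inner_norm subr_ge0.
exists theta => //; split.
  by apply/(self_adjointP (bB theta)) => x y /=; rewrite !innerE sT.
by move=> x; rewrite /= !innerE inner_norm subr_ge0.
Qed.

Lemma op_gt0_surj T y : bounded_op T -> op_gt0 T -> exists x, T x = y.
Proof.
move=> bT /(op_gt0P bT)[sT [theta th0 pT]].
have [||x hx] := @lax_milgram _ _ T theta (fun z => '[z, y]) bT sT th0 pT.
- by move=> a z w; rewrite !innerE.
- by exists `|y| => z; rewrite mulrC; exact: cauchy_schwarz.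
by exists x; apply: inner_inj => z; rewrite innerC hx.
Qed.

Lemma op_gt0_inj T : bounded_op T -> op_gt0 T -> injective T.
Proof.
move=> bT /(op_gt0P bT)[sT [theta th0 pT]] x y xy.
have /eqP := bop_B bT x y; rewrite xy subrr => /eqP Txy.
have := pT (x - y); rewrite Txy inner0l pmulr_rle0// => h.
apply/eqP; rewrite -subr_eq0 -normr_eq0 -sqrf_eq0.
by apply/eqP/le_anti; rewrite h exprn_ge0.
Qed.

Lemma op_invK T x : bounded_op T -> op_gt0 T -> op_inv T (T x) = x.
Proof.
move=> bT pT; apply: pinvKV; last exact: in_setT.
by move=> ? ? _ _; exact: op_gt0_inj.
Qed.

Lemma op_invKV T y : bounded_op T -> op_gt0 T -> T (op_inv T y) = y.
Proof.
by move=> bT pT; have [x <-] := op_gt0_surj y bT pT; rewrite op_invK.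
Qed.

Lemma bounded_op_inv T : bounded_op T -> op_gt0 T -> bounded_op (op_inv T).
Proof.
move=> bT pT; split=> [a x y|].
  apply: (op_gt0_inj bT pT); rewrite (bop_P bT) !op_invKV//.
have /(op_gt0P bT)[sT [theta th0 cT]] := pT.
exists theta^-1 => [|y]; first by rewrite invr_ge0 ltW.
rewrite ler_pdivlMl//.
set x := op_inv T y.
have [->|h] := eqVneq x 0; first by rewrite normr0 mulr0.
rewrite -(@ler_pM2r _ `|x|) ?normr_gt0// -mulrA -expr2.
apply: le_trans (cT x) _; rewrite /x op_invKV//; exact: inner_le.
Qed.

End coercive_operators.

(** The form in which boundedness passes to mean squares. *)
Lemma bounded_op_sum_sqr {R : realType} {X Y Z : normedModType R}
    (f : X -> Z) (g : Y -> Z) : bounded_op f -> bounded_op g ->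
  exists2 M, 0 <= M &
    forall x y, `|f x + g y| ^+ 2 <= M * (`|x| ^+ 2 + `|y| ^+ 2).
Proof.
move=> [_ [M M0 hM]] [_ [L L0 hL]].
exists (2 * (M ^+ 2 + L ^+ 2)) => [|x y].
  by rewrite mulr_ge0// addr_ge0 ?sqr_ge0.
have h1 : `|f x + g y| <= M * `|x| + L * `|y|.
  by apply: le_trans (ler_normD _ _) _; exact: lerD.
have h2 : `|f x + g y| ^+ 2 <= (M * `|x| + L * `|y|) ^+ 2.
  by rewrite ler_pXn2r ?nnegrE ?addr_ge0 ?mulr_ge0.
apply: le_trans h2 _.
have := sqr_ge0 (M * `|x| - L * `|y|).
have := mulr_ge0 (sqr_ge0 M) (sqr_ge0 `|y|).
have := mulr_ge0 (sqr_ge0 L) (sqr_ge0 `|x|).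
by rewrite !sqrrD sqrrN !exprMn; nra.
Qed.

(** * One stage of the quadratic game *)

Section quadratic_forms.
Context {R : realType} {X : hilbertType R} (Q : X -> X).
Hypotheses (bQ : bounded_op Q) (sQ : symmetric_op Q).

Lemma quad_expand x h :
  '[Q (x + h), x + h] = '[Q x, x] + 2 * '[Q x, h] + '[Q h, h].
Proof. by rewrite (bop_D bQ) !innerE (sQ h x) (innerC h); ring. Qed.

End quadratic_forms.

Lemma symmetric_op_inv {R : realType} {X : hilbertType R} (T : X -> X) :
  bounded_op T -> op_gt0 T -> symmetric_op (op_inv T).
Proof.
move=> bT pT x y; have /(op_gt0P bT)[sT _] := pT.
by rewrite -{2}[x](op_invKV _ bT pT) sT op_invKV.
Qed.

Section stage.
Context {R : realType} {H U V Z : hilbertType R} (S : plant H U V Z).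
Context (gamma : R) (P : nat -> {bounded H -> H}) (k : nat).

Definition drift (x : H) (v : V) (u : U) : H :=
  opA S k x + opB1 S k v + opB2 S k u.
Definition diffusion (x : H) (v : V) (u : U) : H :=
  opC S k x + opD1 S k v + opD2 S k u.

(** The conditional expectation, given the present state x, of <P x', x'> at the
    next state x' plus the running payoff |z|^2 - gamma^2 |v|^2: the noise has
    conditional mean 0 and variance 1, so drift and diffusion contribute
    separately. *)
Definition stage_payoff (x : H) (v : V) (u : U) : R :=
  '[P k.+1 (drift x v u), drift x v u]
  + '[P k.+1 (diffusion x v u), diffusion x v u]
  + `|output S k x u| ^+ 2 - gamma ^+ 2 * `|v| ^+ 2.

Let bA := bounded_opP (opA S k).
Let bB1 := bounded_opP (opB1 S k).
Let bB2 := bounded_opP (opB2 S k).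
Let bC := bounded_opP (opC S k).
Let bD1 := bounded_opP (opD1 S k).
Let bD2 := bounded_opP (opD2 S k).
Let bCbar := bounded_opP (opCbar S k).
Let bGbar := bounded_opP (opGbar S k).
Let bP := bounded_opP (P k.+1).

Lemma bounded_sandwich {X Y : hilbertType R} (f : X -> H) (g : Y -> H) :
  bounded_op f -> bounded_op g -> bounded_op (adj g \o P k.+1 \o f).
Proof.
move=> bf bg; do 2!apply: bounded_op_comp => //.
exact: bounded_op_adj.
Qed.

Lemma inner_sandwich {X Y : hilbertType R} (f : X -> H) (g : Y -> H) x y :
  bounded_op g -> '[(adj g \o P k.+1 \o f) x, y] = '[P k.+1 (f x), g y].
Proof. by move=> bg /=; rewrite innerC -(adjP bg) innerC. Qed.

Lemma bounded_calR1 : bounded_op (calR1 S gamma P k).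
Proof.
apply: bounded_opB; last exact: bounded_sandwich.
apply: bounded_opB; last exact: bounded_sandwich.
by apply: bounded_opZ; exact: bounded_op_id.
Qed.

Lemma bounded_calR2 : bounded_op (calR2 S P k).
Proof.
apply: bounded_opD; last exact: bounded_sandwich.
by apply: bounded_opD; [exact: bounded_op_id|exact: bounded_sandwich].
Qed.

Lemma inner_calR1 v w : '[calR1 S gamma P k v, w] =
  gamma ^+ 2 * '[v, w] - '[P k.+1 (opB1 S k v), opB1 S k w]
    - '[P k.+1 (opD1 S k v), opD1 S k w].
Proof. by rewrite !innerDl !innerNl !inner_sandwich// innerZl. Qed.

Lemma inner_calR2 u w : '[calR2 S P k u, w] =
  '[u, w] + '[P k.+1 (opB2 S k u), opB2 S k w]
    + '[P k.+1 (opD2 S k u), opD2 S k w].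
Proof. by rewrite !innerDl !inner_sandwich. Qed.

Section feedback.
Context (K1 : nat -> {bounded H -> V}) (K2 : nat -> {bounded H -> U}).

Let AK := opA S k \+ (opB2 S k \o K2 k).
Let CK := opC S k \+ (opD2 S k \o K2 k).

Let bAK : bounded_op AK.
Proof.
apply: bounded_opD => //; apply: bounded_op_comp => //; exact: bounded_opP.
Qed.

Let bCK : bounded_op CK.
Proof.
apply: bounded_opD => //; apply: bounded_op_comp => //; exact: bounded_opP.
Qed.

Lemma bounded_calG1 : bounded_op (calG1 S P K2 k).
Proof.
by apply: bounded_opB; [apply: bounded_opN|]; exact: bounded_sandwich.
Qed.

Lemma inner_calG1 x v : '[calG1 S P K2 k x, v] =
  - '[P k.+1 (AK x), opB1 S k v] - '[P k.+1 (CK x), opD1 S k v].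
Proof. by rewrite innerDl !innerNl !inner_sandwich. Qed.

Lemma inner_calG2 x u : '[calG2 S P K1 k x, u] =
  '[P k.+1 (opA S k x + opB1 S k (K1 k x)), opB2 S k u]
  + '[P k.+1 (opC S k x + opD1 S k (K1 k x)), opD2 S k u].
Proof. by rewrite innerDl !inner_sandwich. Qed.

Hypothesis pR1 : op_gt0 (calR1 S gamma P k).

Lemma bounded_riccati_rhs : bounded_op (riccati_rhs S gamma P K2 k).
Proof.
have bK2 := bounded_opP (K2 k).
apply: bounded_opD; last first.
  apply: bounded_op_comp bounded_calG1.
  apply: bounded_op_comp; first exact: bounded_op_adj bounded_calG1.
  exact: bounded_op_inv bounded_calR1 pR1.
apply: bounded_opD; last by apply: bounded_op_comp => //; exact: bounded_op_adj.
apply: bounded_opD; last by apply: bounded_op_comp => //; exact: bounded_op_adj.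
by apply: bounded_opD; exact: bounded_sandwich.
Qed.

Lemma inner_riccati_rhs x y : '[riccati_rhs S gamma P K2 k x, y] =
  '[P k.+1 (AK x), AK y] + '[P k.+1 (CK x), CK y] + '[K2 k x, K2 k y]
  + '[opCbar S k x, opCbar S k y]
  + '[op_inv (calR1 S gamma P k) (calG1 S P K2 k x), calG1 S P K2 k y].
Proof.
have bK2 := bounded_opP (K2 k).
rewrite !innerDl !inner_sandwich//=.
rewrite !(innerC (adj _ _) y).
rewrite -(adjP bK2) -(adjP bCbar) -(adjP bounded_calG1).
rewrite (innerC (K2 k y)) (innerC (opCbar S k y)).
by rewrite (innerC (calG1 S P K2 k y)).
Qed.

End feedback.

Hypothesis sP : symmetric_op (P k.+1).

Lemma symmetric_calR1 : symmetric_op (calR1 S gamma P k).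
Proof.
move=> v w; rewrite (innerC v) !inner_calR1 (innerC w).
rewrite (sP (opB1 S k w)) (sP (opD1 S k w)).
by rewrite (innerC (opB1 S k w)) (innerC (opD1 S k w)).
Qed.

Lemma symmetric_calR2 : symmetric_op (calR2 S P k).
Proof.
move=> v w; rewrite (innerC v) !inner_calR2 (innerC w).
rewrite (sP (opB2 S k w)) (sP (opD2 S k w)).
by rewrite (innerC (opB2 S k w)) (innerC (opD2 S k w)).
Qed.

Lemma symmetric_riccati_rhs K2 : op_gt0 (calR1 S gamma P k) ->
  symmetric_op (riccati_rhs S gamma P K2 k).
Proof.
move=> pR1 x y; rewrite (innerC x) !inner_riccati_rhs//.
set a := opA S k \+ _; set c := opC S k \+ _.
rewrite (sP (a x)) (sP (c x)) (innerC (a x)) (innerC (c x)).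
rewrite (innerC (K2 k x)) (innerC (opCbar S k x)).
by rewrite (symmetric_op_inv bounded_calR1 pR1) (innerC (calG1 S P K2 k x)).
Qed.

Lemma stage_payoff_shift_v x v u h : stage_payoff x (v + h) u =
  stage_payoff x v u
  + 2 * ('[P k.+1 (drift x v u), opB1 S k h]
         + '[P k.+1 (diffusion x v u), opD1 S k h] - gamma ^+ 2 * '[v, h])
  - '[calR1 S gamma P k h, h].
Proof.
have dE : drift x (v + h) u = drift x v u + opB1 S k h.
  by rewrite /drift (bop_D bB1) addrA [LHS]addrAC.
have fE : diffusion x (v + h) u = diffusion x v u + opD1 S k h.
  by rewrite /diffusion (bop_D bD1) addrA [LHS]addrAC.
rewrite /stage_payoff dE fE !(quad_expand bP sP) inner_calR1.
by rewrite -(inner_norm (v + h)) -(inner_norm v) !innerE (innerC h v); ring.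
Qed.

Hypothesis GC0 : adj (opGbar S k) \o opCbar S k =1 (fun=> 0).
Hypothesis GG1 : adj (opGbar S k) \o opGbar S k =1 idfun.

Lemma output_sqr x u :
  `|output S k x u| ^+ 2 = `|opCbar S k x| ^+ 2 + `|u| ^+ 2.
Proof.
rewrite -!inner_norm /output !innerE.
have GC : '[opGbar S k u, opCbar S k x] = 0.
  by rewrite (adjP bGbar); have /= -> := GC0 x; rewrite inner0r.
have GG : '[opGbar S k u, opGbar S k u] = '[u, u].
  by rewrite (adjP bGbar); have /= -> := GG1 u.
by rewrite (innerC (opCbar S k x)) GC GG add0r addr0.
Qed.

Lemma stage_payoff_shift_u x v u h : stage_payoff x v (u + h) =
  stage_payoff x v u
  + 2 * ('[P k.+1 (drift x v u), opB2 S k h]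
         + '[P k.+1 (diffusion x v u), opD2 S k h] + '[u, h])
  + '[calR2 S P k h, h].
Proof.
have dE : drift x v (u + h) = drift x v u + opB2 S k h.
  by rewrite /drift (bop_D bB2) addrA.
have fE : diffusion x v (u + h) = diffusion x v u + opD2 S k h.
  by rewrite /diffusion (bop_D bD2) addrA.
rewrite /stage_payoff dE fE !(quad_expand bP sP) inner_calR2 !output_sqr.
by rewrite -(inner_norm (u + h)) -(inner_norm u) !innerE (innerC h u); ring.
Qed.

(** The coupled gains K1, K2 are the stationary point of the stage payoff, and
    the right-hand side of the Riccati equation is its value there. *)
Section saddle_point.
Context (K1 : nat -> {bounded H -> V}) (K2 : nat -> {bounded H -> U}).
Hypothesis K1E : forall x, calR1 S gamma P k (K1 k x) = - calG1 S P K2 k x.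
Hypothesis K2E : forall x, calR2 S P k (K2 k x) = - calG2 S P K1 k x.
Hypothesis pR1 : op_gt0 (calR1 S gamma P k).
Hypothesis PE : P k =1 riccati_rhs S gamma P K2 k.

Lemma payoff_at_saddle x : stage_payoff x (K1 k x) (K2 k x) = '[P k x, x].
Proof.
rewrite -{1}[K1 k x]add0r stage_payoff_shift_v K1E PE inner_riccati_rhs//.
rewrite /stage_payoff /drift /diffusion output_sqr (bop_0 bB1) (bop_0 bD1).
rewrite !addr0 inner0l normr0 innerNl.
have -> : op_inv (calR1 S gamma P k) (calG1 S P K2 k x) = - K1 k x.
  rewrite -[calG1 _ _ _ _ _]opprK -K1E.
  rewrite (bop_N (bounded_op_inv bounded_calR1 pR1)).
  by rewrite (op_invK _ bounded_calR1 pR1).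
rewrite innerNl (innerC (K1 k x)) inner_calG1 -!inner_norm /=.
ring.
Qed.

(** The square completed around the stationary point: the equation for K1 kills
    the first-order term in v, and -R1 is the second-order part. *)
Lemma payoff_disturbance x v : stage_payoff x v (K2 k x) =
  '[P k x, x] - '[calR1 S gamma P k (v - K1 k x), v - K1 k x].
Proof.
rewrite -{1}[v](subrKC (K1 k x)) stage_payoff_shift_v payoff_at_saddle.
set h := v - _.
suff -> : '[P k.+1 (drift x (K1 k x) (K2 k x)), opB1 S k h]
    + '[P k.+1 (diffusion x (K1 k x) (K2 k x)), opD1 S k h]
    - gamma ^+ 2 * '[K1 k x, h] = 0 by rewrite mulr0 addr0.
have := congr1 (fun w => '[w, h]) (K1E x).
rewrite inner_calR1 innerNl inner_calG1 /drift /diffusion /=.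
rewrite -!(addrAC _ (opB2 S k _)) -!(addrAC _ (opD2 S k _)) => h1.
by rewrite !(bop_D bP (_ + _)) !innerDl; lra.
Qed.

(** The same in u: the equation for K2 kills the first-order term, and R2 is the
    second-order part. *)
Lemma payoff_control x u : stage_payoff x (K1 k x) u =
  '[P k x, x] + '[calR2 S P k (u - K2 k x), u - K2 k x].
Proof.
rewrite -{1}[u](subrKC (K2 k x)) stage_payoff_shift_u payoff_at_saddle.
set h := u - _.
suff -> : '[P k.+1 (drift x (K1 k x) (K2 k x)), opB2 S k h]
    + '[P k.+1 (diffusion x (K1 k x) (K2 k x)), opD2 S k h]
    + '[K2 k x, h] = 0 by rewrite mulr0 addr0.
have := congr1 (fun w => '[w, h]) (K2E x).
rewrite inner_calR2 innerNl inner_calG2 /drift /diffusion => h1.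
by rewrite !(bop_D bP (_ + _)) !innerDl; lra.
Qed.

End saddle_point.

End stage.

Section riccati_step.
Context {R : realType} {H U V Z : hilbertType R} (S : plant H U V Z).
Context (gamma : R).
Implicit Types (P : nat -> {bounded H -> H}) (k : nat).

(** A single time is isolated because solutions are built backwards, one stage
    after another. *)
Definition riccati_stage P (K1 : nat -> {bounded H -> V})
    (K2 : nat -> {bounded H -> U}) k : Prop :=
  [/\ K1 k =1 \- (op_inv (calR1 S gamma P k) \o calG1 S P K2 k),
      K2 k =1 \- (op_inv (calR2 S P k) \o calG2 S P K1 k),
      op_gt0 (calR1 S gamma P k), op_gt0 (calR2 S P k)
    & P k =1 riccati_rhs S gamma P K2 k].

Lemma riccati_stage_K1 P K1 K2 k : riccati_stage P K1 K2 k ->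
  forall x, calR1 S gamma P k (K1 k x) = - calG1 S P K2 k x.
Proof.
move=> [K1E _ pR1 _ _] x; have bR1 := bounded_calR1 S gamma P k.
by rewrite K1E /= (bop_N bR1) (op_invKV _ bR1 pR1).
Qed.

Lemma riccati_stage_K2 P K1 K2 k : riccati_stage P K1 K2 k ->
  forall x, calR2 S P k (K2 k x) = - calG2 S P K1 k x.
Proof.
move=> [_ K2E _ pR2 _] x; have bR2 := bounded_calR2 S P k.
by rewrite K2E /= (bop_N bR2) (op_invKV _ bR2 pR2).
Qed.

Lemma op_gt0_calR2 P k : symmetric_op (P k.+1) ->
  (forall x, 0 <= '[P k.+1 x, x]) -> op_gt0 (calR2 S P k).
Proof.
move=> sP P0; apply/(op_gt0P (bounded_calR2 S P k)); split.
  exact: symmetric_calR2.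
exists 1 => // u; rewrite mul1r inner_calR2 inner_norm -addrA lerDl.
exact: addr_ge0.
Qed.

Section cross_op.
Context {X Y : hilbertType R} (P : nat -> {bounded H -> H}) (k : nat).

(** Half the mixed second derivative of the expected next value <P x', x'> with
    respect to two arguments that enter the drift through f, g and the diffusion
    through f', g'. *)
Definition cross_op (f f' : X -> H) (g g' : Y -> H) : X -> Y :=
  (adj g \o P k.+1 \o f) \+ (adj g' \o P k.+1 \o f').

Lemma bounded_cross_op f f' g g' : bounded_op f -> bounded_op f' ->
  bounded_op g -> bounded_op g' -> bounded_op (cross_op f f' g g').
Proof. by move=> *; apply: bounded_opD; exact: bounded_sandwich. Qed.

Lemma inner_cross_op f f' g g' x y : bounded_op g -> bounded_op g' ->
  '[cross_op f f' g g' x, y] = '[P k.+1 (f x), g y] + '[P k.+1 (f' x), g' y].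
Proof. by move=> *; rewrite innerDl !inner_sandwich. Qed.

End cross_op.

(** Eliminating the disturbance gain from the two stationarity equations leaves
    R2 + M R1^-1 M^* acting on the control gain, with
    M = B2^* P B1 + D2^* P D1.  This operator dominates the identity, hence is
    invertible: the coupled gains exist. *)
Lemma saddle_gains_exist P k :
  symmetric_op (P k.+1) -> (forall x, 0 <= '[P k.+1 x, x]) ->
  op_gt0 (calR1 S gamma P k) ->
  exists (k1 : {bounded H -> V}) (k2 : {bounded H -> U}),
    k1 =1 \- (op_inv (calR1 S gamma P k) \o calG1 S P (fun=> k2) k) /\
    k2 =1 \- (op_inv (calR2 S P k) \o calG2 S P (fun=> k1) k).
Proof.
move=> sP P0 pR1.
have bR1 := bounded_calR1 S gamma P k.
have bR2 := bounded_calR2 S P k.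
have pR2 := op_gt0_calR2 sP P0.
have bP := bounded_opP (P k.+1).
have bA := bounded_opP (opA S k); have bC := bounded_opP (opC S k).
have bB1 := bounded_opP (opB1 S k); have bD1 := bounded_opP (opD1 S k).
have bB2 := bounded_opP (opB2 S k); have bD2 := bounded_opP (opD2 S k).
pose iR1 := op_inv (calR1 S gamma P k).
have biR1 : bounded_op iR1 by exact: bounded_op_inv.
pose M := cross_op P k (opB1 S k) (opD1 S k) (opB2 S k) (opD2 S k).
pose Mt := cross_op P k (opB2 S k) (opD2 S k) (opB1 S k) (opD1 S k).
pose g1 := cross_op P k (opA S k) (opC S k) (opB1 S k) (opD1 S k).
pose g2 := cross_op P k (opA S k) (opC S k) (opB2 S k) (opD2 S k).
have bM : bounded_op M by exact: bounded_cross_op.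
have bMt : bounded_op Mt by exact: bounded_cross_op.
have bg1 : bounded_op g1 by exact: bounded_cross_op.
have bg2 : bounded_op g2 by exact: bounded_cross_op.
have MP v u : '[M v, u] = '[v, Mt u].
  rewrite (innerC v) /M /Mt !inner_cross_op// !sP.
  rewrite (innerC (opB1 S k v)) (innerC (opD1 S k v)).
  by rewrite (sP (opB2 S k u)) (sP (opD2 S k u)).
pose W := calR2 S P k \+ (M \o iR1 \o Mt).
have bW : bounded_op W.
  by apply: bounded_opD => //; do 2!apply: bounded_op_comp => //.
have pW : op_gt0 W.
  apply/(op_gt0P bW); split.
    move=> u w; rewrite /W /= innerDl innerDr (symmetric_calR2 S sP) MP.
    by rewrite (symmetric_op_inv bR1 pR1) (innerC u (M _)) MP (innerC (Mt u)).
  exists 1 => // u; rewrite mul1r /W /= innerDl MP.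
  have h1 : `|u| ^+ 2 <= '[calR2 S P k u, u].
    by rewrite inner_calR2 inner_norm -addrA lerDl addr_ge0.
  apply: le_trans h1 _; rewrite lerDl.
  rewrite -{2}[Mt u](op_invKV _ bR1 pR1) innerC.
  have /(op_gt0P bR1)[_ [theta th0 cR1]] := pR1.
  by apply: le_trans (cR1 _); rewrite mulr_ge0 ?exprn_ge0// ltW.
have bK2 : bounded_op (\- (op_inv W \o (g2 \+ (M \o iR1 \o g1)))).
  apply: bounded_opN; apply: bounded_op_comp; first exact: bounded_op_inv.
  by apply: bounded_opD => //; do 2!apply: bounded_op_comp => //.
have [k2 k2E] := bounded_op_pack bK2.
have bK1 : bounded_op (iR1 \o ((Mt \o k2) \+ g1)).
  apply: bounded_op_comp => //; apply: bounded_opD => //.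
  apply: bounded_op_comp => //; exact: bounded_opP.
have [k1 k1E] := bounded_op_pack bK1.
exists k1, k2; split => x.
  rewrite k1E /= -/iR1 -(bop_N biR1); congr iR1.
  apply: inner_inj => v; rewrite innerC (innerC v) innerNl inner_calG1.
  rewrite (innerDl (Mt _)) !inner_cross_op//=.
  by rewrite !(bop_D bP) !innerDl; ring.
apply: (op_gt0_inj bR2 pR2); rewrite /= (bop_N bR2) (op_invKV _ bR2 pR2).
have : W (k2 x) = - (g2 x + M (iR1 (g1 x))).
  by rewrite k2E /= (bop_N bW) (op_invKV _ bW pW).
rewrite /W /= => /eqP; rewrite eq_sym -subr_eq -opprD => /eqP <-.
congr (- _).
have -> : g2 x + M (iR1 (g1 x)) + M (iR1 (Mt (k2 x))) = g2 x + M (k1 x).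
  rewrite k1E /= (bop_D biR1 (Mt _)) (bop_D bM (iR1 (Mt _))) -addrA.
  by congr (_ + _); rewrite addrC.
apply: inner_inj => u; rewrite innerC (innerC u) inner_calG2.
rewrite (innerDl (g2 x)) !inner_cross_op//.
by rewrite !(bop_D bP) !innerDl; ring.
Qed.

(** Nonnegativity of the new value comes from comparison with the disturbance
    v = 0, against which the running payoff is |z|^2. *)
Lemma riccati_step P k :
  adj (opGbar S k) \o opCbar S k =1 (fun=> 0) ->
  adj (opGbar S k) \o opGbar S k =1 idfun ->
  symmetric_op (P k.+1) -> (forall x, 0 <= '[P k.+1 x, x]) ->
  op_gt0 (calR1 S gamma P k) ->
  exists (p : {bounded H -> H}) (k1 : {bounded H -> V}) (k2 : {bounded H -> U}),
    [/\ symmetric_op p, forall x, 0 <= '[p x, x]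
      & forall P' K1 K2, P' k = p -> P' k.+1 = P k.+1 -> K1 k = k1 ->
          K2 k = k2 -> riccati_stage P' K1 K2 k].
Proof.
move=> GC GG sP P0 pR1.
have [k1 [k2 [k1E k2E]]] := saddle_gains_exist sP P0 pR1.
have bR1 := bounded_calR1 S gamma P k.
have [p pE] := bounded_op_pack (bounded_riccati_rhs (fun=> k2) pR1).
have stageP P' K1 K2 : P' k = p -> P' k.+1 = P k.+1 -> K1 k = k1 ->
    K2 k = k2 -> riccati_stage P' K1 K2 k.
  move=> pk pk1 e1 e2.
  have R1E : calR1 S gamma P' k = calR1 S gamma P k by rewrite /calR1 pk1.
  have R2E : calR2 S P' k = calR2 S P k by rewrite /calR2 pk1.
  have G1E : calG1 S P' K2 k = calG1 S P (fun=> k2) k by rewrite /calG1 pk1 e2.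
  have G2E : calG2 S P' K1 k = calG2 S P (fun=> k1) k by rewrite /calG2 pk1 e1.
  split; rewrite ?R1E ?R2E ?G1E ?G2E ?e1 ?e2//; first exact: op_gt0_calR2.
  by move=> x; rewrite pk pE /riccati_rhs R1E G1E pk1 e2.
exists p, k1, k2; split=> //.
  by rewrite pE; exact: symmetric_riccati_rhs.
pose P' j := if j == k then p else P j.
have P'k : P' k = p by rewrite /P' eqxx.
have P'k1 : P' k.+1 = P k.+1 by rewrite /P' gtn_eqF.
have st := stageP P' (fun=> k1) (fun=> k2) P'k P'k1 erefl erefl.
have [_ _ pR1' _ PE'] := st.
have sP' : symmetric_op (P' k.+1) by rewrite P'k1.
move=> x; rewrite -P'k.
have := payoff_disturbance sP' GC GG (riccati_stage_K1 st) pR1' PE' x 0.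
move=> /eqP; rewrite eq_sym subr_eq => /eqP ->; apply: addr_ge0.
  rewrite /stage_payoff normr0 expr0n mulr0 subr0 P'k1.
  by rewrite addr_ge0 ?exprn_ge0// addr_ge0.
have /(op_gt0P (bounded_calR1 S gamma P' k))[_ [theta th0 cR1]] := pR1'.
by apply: le_trans (cR1 _); rewrite mulr_ge0 ?exprn_ge0// ltW.
Qed.

End riccati_step.

(** * Random variables adapted to the noise *)

Section adapted.
Context {d : measure_display} {T : measurableType d}.
Context (F : set (set T)) (sF : sigma_algebra [set: T] F).

Lemma sigma_algebra_bigcup_countable {I : Type} (D : set I) (A : I -> set T) :
  countable D -> (forall i, D i -> F (A i)) -> F (\bigcup_(i in D) A i).
Proof.
move=> cD FA; have [F0 _ FU] := sF.
have /pfcard_geP[->|/unsquash f] := cD; first by rewrite bigcup_set0.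
have -> : \bigcup_(i in D) A i = \bigcup_n A (f n).
  apply/seteqP; split=> t [i Di Ait].
    by have [n _ fn] := 'surj_f Di; exists n => //; rewrite fn.
  by exists (f i) => //; exact: funS.
by apply: FU => n; apply: FA; exact: funS.
Qed.

Lemma sigma_algebra_setC (A : set T) : F A -> F (~` A).
Proof. by have [_ FC _] := sF; move=> /FC; rewrite setTD. Qed.

Lemma sigma_algebra_setI (A B : set T) : F A -> F B -> F (A `&` B).
Proof.
move=> FA FB; rewrite -[A `&` B]setCK setCI; apply: sigma_algebra_setC.
rewrite -bigcup2E; have [F0 _ FU] := sF; apply: FU => -[|[|n]]//=.
- exact: sigma_algebra_setC.
- exact: sigma_algebra_setC.
Qed.

Lemma measurable_wrtP {X : topologicalType} (q : T -> X) :
  measurable_wrt F q <-> forall O, open O -> F (q @^-1` O).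
Proof.
split=> [mq O oO|h].
  by apply: mq; exists O; rewrite ?setTI//; exact: sub_sigma_algebra.
suff h' : <<s @open X >> `<=` [set B | F (q @^-1` B)].
  by move=> _ [B sB <-]; rewrite setTI; exact: h'.
apply: smallest_sub => //; have [F0 FC FU] := sF; split.
- by rewrite /mkset preimage_set0.
- by move=> B FB; rewrite /mkset setTD preimage_setC; exact: sigma_algebra_setC.
- by move=> B FB; rewrite /mkset preimage_bigcup; exact: FU.
Qed.

Lemma measurable_wrt_cst {X : topologicalType} (x : X) :
  measurable_wrt F (fun=> x).
Proof.
apply/measurable_wrtP => O _; have [F0 _ _] := sF.
have [Ox|nOx] := pselect (O x).
  rewrite (_ : _ @^-1` _ = ~` set0); first exact: sigma_algebra_setC.
  by rewrite setC0; apply/seteqP; split.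
by rewrite (_ : _ @^-1` _ = set0)//; apply/seteqP; split.
Qed.

Lemma measurable_wrt_comp {X Y : topologicalType} (phi : X -> Y) (q : T -> X) :
  continuous phi -> measurable_wrt F q -> measurable_wrt F (phi \o q).
Proof.
move=> cphi /measurable_wrtP mq; apply/measurable_wrtP => O oO.
by apply: (mq (phi @^-1` O)); exact: open_comp.
Qed.

(** An open subset of a product of separable spaces is a countable union of
    products of balls, centred in countable dense sets; without separability
    sums and inner products of random vectors need not be measurable. *)
Lemma measurable_wrt_pair {R : realType} {X Y : normedModType R}
    {W : topologicalType} (phi : X * Y -> W) (q : T -> X) (r : T -> Y) :
  separable X -> separable Y -> continuous phi ->
  measurable_wrt F q -> measurable_wrt F r ->
  measurable_wrt F (fun t => phi (q t, r t)).
Proof.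
move=> [DX cDX dDX] [DY cDY dDY] cphi /measurable_wrtP mq /measurable_wrtP mr.
apply/measurable_wrtP => O oO.
pose good x y n := forall x' y',
  ball x n.+1%:R^-1 x' -> ball y n.+1%:R^-1 y' -> O (phi (x', y')).
pose A x y n := if `[< good x y n >] then
  (q @^-1` ball x n.+1%:R^-1) `&` (r @^-1` ball y n.+1%:R^-1) else set0.
have -> : (fun t => phi (q t, r t)) @^-1` O =
    \bigcup_(x in DX) \bigcup_(y in DY) \bigcup_n A x y n.
  apply/seteqP; split=> [t /= Ot|t [x _ [y _ [n _]]]]; last first.
    by rewrite /A; case: asboolP => // g -[/= h1 h2]; exact: g.
  have /nbhs_ballP[e /= e0 he] : nbhs (q t, r t) (phi @^-1` O).
    by apply: cphi; exact: open_nbhs_nbhs.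
  have e20 : 0 < e / 2 by exact: divr_gt0.
  have [n _ /(_ n (leqnn n)) /= hn] := near_infty_natSinv_lt (PosNum e20).
  have ball0 (V : normedModType R) (v : V) : ball v n.+1%:R^-1 v.
    by apply: ballxx; rewrite invr_gt0.
  have dn (V : normedModType R) (D : set V) (v : V) : dense D ->
      exists2 v', D v' & ball v n.+1%:R^-1 v'.
    move=> /(_ (ball v n.+1%:R^-1)); case; first by exists v; exact: ball0.
      by apply: ball_open; rewrite invr_gt0.
    by move=> v' [? ?]; exists v'.
  have [x Dx xq] := dn _ _ (q t) dDX; have [y Dy yr] := dn _ _ (r t) dDY.
  exists x => //; exists y => //; exists n => //; rewrite /A.
  case: asboolP => [_|]; first by split; exact: ball_sym.
  case=> x' y' xx' yy'; apply: he.
  have hs (V : normedModType R) (v1 v2 v3 : V) : ball v1 n.+1%:R^-1 v2 ->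
      ball v2 n.+1%:R^-1 v3 -> ball v1 e v3.
    move=> b1 b2; have := ball_triangle b1 b2; apply: le_ball.
    by rewrite [e]splitr lerD// ltW.
  by split=> /=; [exact: hs xx'|exact: hs yy'].
apply: sigma_algebra_bigcup_countable => // x _.
apply: sigma_algebra_bigcup_countable => // y _.
have [F0 _ FU] := sF; apply: FU => n; rewrite /A; case: ifP => // _.
by apply: sigma_algebra_setI; [apply: mq|apply: mr]; apply: ball_open;
  rewrite invr_gt0.
Qed.

End adapted.

Section adapted_vectors.
Context {d : measure_display} {T : measurableType d} {R : realType}.
Context (F : set (set T)) (sF : sigma_algebra [set: T] F).

Lemma separableR : separable R.
Proof.
exists (range ratr); last exact: dense_rat.
exact: sub_countable (card_image_le _ _) (countableP _).
Qed.

Section one_space.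
Context {X : normedModType R} (sX : separable X).

Lemma measurable_wrtD (q r : T -> X) : measurable_wrt F q ->
  measurable_wrt F r -> measurable_wrt F (fun t => q t + r t).
Proof.
apply: (measurable_wrt_pair (phi := fun z : X * X => z.1 + z.2) sF sX sX).
exact: add_continuous.
Qed.

Lemma measurable_wrtZ (w : T -> R) (q : T -> X) : measurable_wrt F w ->
  measurable_wrt F q -> measurable_wrt F (fun t => w t *: q t).
Proof.
apply: (measurable_wrt_pair (phi := fun z : R^o * X => z.1 *: z.2)
  sF separableR sX).
exact: scale_continuous.
Qed.

Lemma measurable_wrt_norm (q : T -> X) : measurable_wrt F q ->
  measurable_wrt F (fun t => `|q t|).
Proof. by apply: measurable_wrt_comp => //; exact: norm_continuous. Qed.

End one_space.

Lemma measurable_wrt_op {X Y : normedModType R} (f : X -> Y) (q : T -> X) :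
  bounded_op f -> measurable_wrt F q -> measurable_wrt F (f \o q).
Proof.
move=> /bounded_op_pack[g <-]; apply: measurable_wrt_comp => //.
exact: cts_fun.
Qed.

Hypothesis subF : F `<=` @measurable d T.

Lemma measurable_wrt_fun (g : T -> R) : measurable_wrt F g ->
  measurable_fun [set: T] g.
Proof.
move=> /(measurable_wrtP sF) mg.
apply: (measurability _ (RGenOpens.measurableE R)) => _ [B [a [b ->]] <-].
by rewrite setTI; apply: subF; apply: mg; exact: interval_open.
Qed.

End adapted_vectors.

Import HBNNSimple.

Section noise.
Context {d : measure_display} {T : measurableType d} {R : realType}.
Context (Pr : probability T R).
Context (F : set (set T)) (sF : sigma_algebra [set: T] F).
Hypothesis subF : F `<=` @measurable d T.

(** The weight g is a monotone limit of simple functions over F, and against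
    these the two densities agree by hypothesis. Applied to w^2 and 1, and to
    |w| + w and |w|, this extends the two conditional moments of the noise w
    from the sets of F to adapted weights. *)
Lemma ge0_weighted_integral_eq (f1 f2 g : T -> R) :
  measurable_fun [set: T] f1 -> measurable_fun [set: T] f2 ->
  (forall t, 0 <= f1 t) -> (forall t, 0 <= f2 t) ->
  (forall A, F A ->
    \int[Pr]_(t in A) (f1 t)%:E = \int[Pr]_(t in A) (f2 t)%:E)%E ->
  measurable_wrt F g -> (forall t, 0 <= g t) ->
  (\int[Pr]_t (g t * f1 t)%:E = \int[Pr]_t (g t * f2 t)%:E)%E.
Proof.
move=> mf1 mf2 f10 f20 f12 mg g0.
pose T' := g_sigma_algebraType F.
have mT' (A : set T') : measurable A = F A.
  by rewrite /measurable /= sigma_algebra_id.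
have mgT' : measurable_fun [set: T'] (EFin \o g : T' -> \bar R).
  apply/measurable_EFinP.
  apply: (measurability _ (RGenOpens.measurableE R)) => _ [B [a [b ->]] <-].
  rewrite setTI mT'; apply: (measurable_wrtP sF g).1 => //;
    exact: interval_open.
pose h := nnsfun_approx measurableT mgT'.
have FhP n y : F (h n @^-1` [set y]).
  by rewrite -mT'; exact: measurable_funPTI.
have mh n : measurable_fun [set: T] (h n).
  move=> _ B mB; rewrite setTI; apply: subF; rewrite -mT'.
  exact: measurable_funPTI.
have hlim t : EFin \o h^~ t @ \oo --> (g t)%:E.
  by apply: (@cvg_nnsfun_approx _ T' R setT measurableT _ mgT') => //= x _;
    rewrite lee_fin.
have hmon t : {homo h^~ t : n m / (n <= m)%N >-> n <= m}.
  by move=> n m nm; exact/lefP/(nd_nnsfun_approx measurableT mgT').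
have step (f : T -> R) : measurable_fun [set: T] f -> (forall t, 0 <= f t) ->
    (forall n, (\int[Pr]_t (h n t * f t)%:E)%E =
      \sum_(y \in range (h n))
        (\int[Pr]_t (y * (\1_(h n @^-1` [set y]) t * f t))%:E)%E) /\
    (fun n => \int[Pr]_t (h n t * f t)%:E)%E @ \oo -->
      (\int[Pr]_t (g t * f t)%:E)%E.
  move=> mf f0; split=> [n|].
    rewrite -ge0_integral_fsum//.
    - apply: eq_integral => t _; rewrite fsumEFin// fimfunE mulr_fsuml.
      by congr EFin; apply: eq_fsbigr => y _; rewrite mulrA.
    - move=> y; apply/measurable_EFinP; apply: measurable_funM => //.
      apply: measurable_funM => //; apply: measurable_indic; exact/subF.
    move=> y t _; rewrite mulrA EFinM mule_ge0 ?lee_fin//.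
    exact: nnfun_muleindic_ge0.
  have -> : (fun t => (g t * f t)%:E) =
      (fun t => limn (fun n => (h n t * f t)%:E)).
    apply/funext => t; apply/esym/cvg_lim => //.
    under eq_fun do rewrite EFinM.
    by rewrite EFinM; apply: cvgeZr => //; exact: hlim.
  apply: cvg_monotone_convergence => //.
  - by move=> n; apply/measurable_EFinP; exact: measurable_funM.
  - by move=> n t _; rewrite lee_fin mulr_ge0.
  by move=> t _ n m nm; rewrite lee_fin ler_wpM2r//; exact: hmon.
have [e1 c1] := step _ mf1 f10; have [e2 c2] := step _ mf2 f20.
suff e n : (\int[Pr]_t (h n t * f1 t)%:E = \int[Pr]_t (h n t * f2 t)%:E)%E.
  rewrite -(cvg_lim _ c1)// -(cvg_lim _ c2)//; congr (limn _).
  exact/funext.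
rewrite e1 e2; apply: eq_fsbigr => y _.
have term (f : T -> R) : measurable_fun [set: T] f -> (forall t, 0 <= f t) ->
    (\int[Pr]_t (y * (\1_(h n @^-1` [set y]) t * f t))%:E)%E =
    if 0 <= y then (y%:E * \int[Pr]_(t in h n @^-1` [set y]) (f t)%:E)%E
    else 0%E.
  move=> mf f0; case: ifPn => y0.
    under eq_integral do rewrite EFinM.
    rewrite ge0_integralZl_EFin//.
    - congr (_ * _)%E; rewrite [in RHS]integral_mkcond.
      apply: eq_integral => t _; rewrite /patch indicE.
      by case: ifPn => _; rewrite ?mul1r ?mul0r.
    - by move=> t _; rewrite lee_fin mulr_ge0.
    apply/measurable_EFinP; apply: measurable_funM => //.
    by apply: measurable_indic; exact/subF.
  apply: integral0_eq => t _; rewrite indicE.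
  case: (boolP (t \in _)) => [/set_mem /= ht|_]; last by rewrite mul0r mulr0.
  by move: y0; rewrite -ht fun_ge0.
by rewrite !term//; case: ifPn => // _; rewrite f12.
Qed.

Section centered_unit_noise.
Context (w : T -> R) (mw : measurable_fun [set: T] w).
Hypothesis hw : forall A, F A -> (\int[Pr]_(t in A) (w t)%:E = 0 /\
  \int[Pr]_(t in A) (w t ^+ 2)%:E = Pr A)%E.

Let FT : F [set: T].
Proof. by have [F0 FC _] := sF; have := FC _ F0; rewrite setD0. Qed.

Lemma noise_integrable : Pr.-integrable [set: T] (EFin \o w).
Proof.
(* |w| <= 1 + w^2, and w^2 has integral 1. *)
have i2 : Pr.-integrable [set: T] (EFin \o (fun t => w t ^+ 2)).
  apply/integrableP; split; first exact/measurable_EFinP/measurable_funX.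
  under eq_integral do rewrite gee0_abs ?lee_fin ?sqr_ge0//.
  by rewrite (hw FT).2 (le_lt_trans (probability_le1 _ _))// ltry.
have i1 : Pr.-integrable [set: T] (EFin \o (fun t => 1 + w t ^+ 2)).
  have i0 : Pr.-integrable [set: T] (EFin \o cst 1).
    exact: finite_measure_integrable_cst.
  exact: eq_integrable (integrableD measurableT i0 i2).
apply: le_integrable i1 => //; first exact/measurable_EFinP.
move=> t _; rewrite /= lee_fin [leRHS]ger0_norm ?addr_ge0 ?sqr_ge0//.
have := sqr_ge0 (`|w t| - 1); rewrite -[w t ^+ 2]real_normK ?num_real//.
have := normr_ge0 (w t); nra.
Qed.

Lemma noise_second_moment (g : T -> R) : measurable_wrt F g ->
  (forall t, 0 <= g t) ->
  (\int[Pr]_t (g t * w t ^+ 2)%:E = \int[Pr]_t (g t)%:E)%E.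
Proof.
move=> mg g0; rewrite (@ge0_weighted_integral_eq _ (cst 1) g)//=.
- by apply: eq_integral => t _; rewrite mulr1.
- exact: measurable_funX.
- by move=> t; exact: sqr_ge0.
move=> A FA; rewrite (hw FA).2 integral_cst ?mul1e//; exact: subF.
Qed.

Lemma noise_second_moment_integrable (g : T -> R) : measurable_wrt F g ->
  Pr.-integrable [set: T] (EFin \o g) ->
  Pr.-integrable [set: T] (EFin \o (fun t => g t * w t ^+ 2)) ->
  \int[Pr]_t (g t * w t ^+ 2) = \int[Pr]_t g t.
Proof.
move=> mg ig ig2.
(* g is the difference of the nonnegative weights |g| + g and |g|. *)
have mng := measurable_wrt_norm sF mg.
have mgg := measurable_wrtD sF (@separableR R) mng mg.
have ing := integrable_norm ig.
have ing2 : Pr.-integrable [set: T] (EFin \o (fun t => `|g t| * w t ^+ 2)).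
  apply: eq_integrable (integrable_norm ig2) => // t _ /=.
  by rewrite normrM (ger0_norm (sqr_ge0 _)).
have e1 := congr1 fine (noise_second_moment mng (fun t => normr_ge0 (g t))).
have := congr1 fine (noise_second_moment mgg _).
rewrite -!/(Rintegral _ _ _) in e1 *.
under eq_Rintegral do rewrite mulrDl.
rewrite RintegralD// RintegralD// => e2.
apply: (addrI (\int[Pr]_t `|g t|)); rewrite -e2 -?e1// => t.
by have := ler_norm (- g t); rewrite normrN; lra.
Qed.

Lemma ge0_noise_mean (g : T -> R) : measurable_wrt F g ->
  (forall t, 0 <= g t) -> Pr.-integrable [set: T] (EFin \o (g \* w)) ->
  \int[Pr]_t (g t * w t) = 0.
Proof.
move=> mg g0 ig.
have nw : measurable_fun [set: T] (fun t => `|w t|).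
  exact: measurableT_comp.
have ign : Pr.-integrable [set: T] (EFin \o (fun t => g t * `|w t|)).
  apply: le_integrable ig => //.
    apply/measurable_EFinP; apply: measurable_funM => //.
    exact: measurable_wrt_fun mg.
  by move=> t _; rewrite /= lee_fin !normrM normr_id.
(* w is the difference of the nonnegative densities |w| + w and |w|. *)
have := @ge0_weighted_integral_eq (fun t => `|w t| + w t) (fun t => `|w t|) g.
move=> /(_ (measurable_funD nw mw) nw) e.
have {}e : \int[Pr]_t (g t * `|w t| + g t * w t) = \int[Pr]_t (g t * `|w t|).
  congr fine; rewrite -e//.
  - by apply: eq_integral => t _; rewrite mulrDr.
  - by move=> t; have := ler_norm (- w t); rewrite normrN; lra.
  move=> A FA.
  have iw : Pr.-integrable A (EFin \o w).
    by apply: integrableS noise_integrable => //; exact: subF.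
  under eq_integral do rewrite EFinD.
  rewrite integralD//; [|exact: subF|exact: integrable_norm].
  by rewrite (hw FA).1 adde0.
move: e; rewrite RintegralD//; move=> /eqP.
by rewrite -subr_eq0 addrAC subrr add0r => /eqP.
Qed.

Lemma noise_mean (g : T -> R) : measurable_wrt F g ->
  Pr.-integrable [set: T] (EFin \o (g \* w)) -> \int[Pr]_t (g t * w t) = 0.
Proof.
move=> mg ig.
(* The same splitting of the weight. *)
have mng := measurable_wrt_norm sF mg.
have mgg := measurable_wrtD sF (@separableR R) mng mg.
have mgT := measurable_wrt_fun sF subF mg.
have in1 : Pr.-integrable [set: T] (EFin \o ((fun t => `|g t|) \* w)).
  apply: le_integrable ig => //.
    apply/measurable_EFinP; apply: measurable_funM => //.
    exact: measurable_wrt_fun mng.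
  by move=> t _; rewrite /= lee_fin !normrM normr_id.
have in2 : Pr.-integrable [set: T] (EFin \o ((fun t => `|g t| + g t) \* w)).
  apply: eq_integrable (integrableD measurableT in1 ig) => // t _ /=.
  by rewrite mulrDl EFinD.
have := ge0_noise_mean mgg _ in2.
under eq_Rintegral do rewrite mulrDl.
rewrite RintegralD// (ge0_noise_mean mng)// add0r; apply => t.
by have := ler_norm (- g t); rewrite normrN; lra.
Qed.

End centered_unit_noise.
End noise.

Section square_integrable.
Context {d : measure_display} {T : measurableType d} {R : realType}.
Context (Pr : probability T R).
Implicit Types (F : set (set T)).

Definition sqr_integrable F {X : normedModType R} (q : T -> X) : Prop :=
  measurable_wrt F q /\
  Pr.-integrable [set: T] (EFin \o (fun t => `|q t| ^+ 2)).

Lemma inner_continuous {X : hilbertType R} :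
  continuous (fun z : X * X => '[z.1, z.2]).
Proof.
(* Polarization, to use the continuity of the norm. *)
have -> : (fun z : X * X => '[z.1, z.2]) =
    (fun z => 2^-1 * (`|z.1 + z.2| ^+ 2 - `|z.1| ^+ 2 - `|z.2| ^+ 2)).
  apply/funext => z; rewrite -!inner_norm !innerE (innerC z.2); lra.
move=> z; apply: cvgMr; apply: cvgB; first apply: cvgB.
- have h : `|y.1 + y.2| @[y --> z] --> `|z.1 + z.2|.
    by apply: cvg_norm; exact: add_continuous.
  by exact: (cvgM h h).
- have h : `|y.1| @[y --> z] --> `|z.1| by apply: cvg_norm; exact: cvg_fst.
  by exact: (cvgM h h).
have h : `|y.2| @[y --> z] --> `|z.2| by apply: cvg_norm; exact: cvg_snd.
by exact: (cvgM h h).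
Qed.

Section fixed_sigma_algebra.
Context (F : set (set T)) (sF : sigma_algebra [set: T] F).
Hypothesis subF : F `<=` @measurable d T.

Lemma le_integrable_fin (f g : T -> R) : measurable_wrt F f ->
  Pr.-integrable [set: T] (EFin \o g) -> (forall t, `|f t| <= g t) ->
  Pr.-integrable [set: T] (EFin \o f).
Proof.
move=> mf ig fg; apply: le_integrable ig => //.
  by apply/measurable_EFinP; exact: measurable_wrt_fun mf.
by move=> t _; rewrite /= lee_fin; apply: le_trans (fg t) (ler_norm _).
Qed.

Lemma measurable_wrt_normX {X : normedModType R} (q : T -> X) :
  measurable_wrt F q -> measurable_wrt F (fun t => `|q t| ^+ 2).
Proof.
apply: (measurable_wrt_comp sF (phi := fun x : X => `|x| ^+ 2)) => x.
have h : `|y| @[y --> x] --> `|x| by exact: norm_continuous.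
by exact: (cvgM h h).
Qed.

Lemma integrable_comb (a b : R) (f g : T -> R) :
  Pr.-integrable [set: T] (EFin \o f) -> Pr.-integrable [set: T] (EFin \o g) ->
  Pr.-integrable [set: T] (EFin \o (fun t => a * f t + b * g t)).
Proof.
move=> fi gi; have := integrableZl measurableT b gi.
have := integrableZl measurableT a fi; exact: integrableD.
Qed.

Section vectors.
Context {X : hilbertType R} (sX : separable X).

Lemma sqr_integrable_cst (x : X) : sqr_integrable F (fun=> x).
Proof.
split; first exact: measurable_wrt_cst.
exact: finite_measure_integrable_cst.
Qed.

Lemma sqr_integrableD (q r : T -> X) : sqr_integrable F q ->
  sqr_integrable F r -> sqr_integrable F (fun t => q t + r t).
Proof.
move=> [mq iq] [mr ir]; have mqr := measurable_wrtD sF sX mq mr; split=> //.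
apply: (le_integrable_fin _ (integrable_comb 2 2 iq ir)) => [|t].
  exact: measurable_wrt_normX.
rewrite ger0_norm ?sqr_ge0//; have := ler_normD (q t) (r t).
have := normr_ge0 (q t); have := normr_ge0 (r t).
have := normr_ge0 (q t + r t); have := sqr_ge0 (`|q t| - `|r t|); nra.
Qed.

Lemma measurable_wrt_inner (q r : T -> X) : measurable_wrt F q ->
  measurable_wrt F r -> measurable_wrt F (fun t => '[q t, r t]).
Proof.
exact: (measurable_wrt_pair sF sX sX inner_continuous).
Qed.

Lemma abs_inner_le (x y : X) : `|'[x, y]| <= 1 * `|x| ^+ 2 + 1 * `|y| ^+ 2.
Proof.
have := cauchy_schwarz x y; have := normr_ge0 x; have := normr_ge0 y.
have := sqr_ge0 (`|x| - `|y|); nra.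
Qed.

Lemma integrable_inner (q r : T -> X) : sqr_integrable F q ->
  sqr_integrable F r ->
  Pr.-integrable [set: T] (EFin \o (fun t => '[q t, r t])).
Proof.
move=> [mq iq] [mr ir].
apply: (le_integrable_fin _ (integrable_comb 1 1 iq ir)) => [|t].
  exact: measurable_wrt_inner.
exact: abs_inner_le.
Qed.

End vectors.

Lemma sqr_integrable_op {X Y : normedModType R} (f : X -> Y) (q : T -> X) :
  bounded_op f -> sqr_integrable F q -> sqr_integrable F (fun t => f (q t)).
Proof.
move=> bf [mq iq]; have mfq := measurable_wrt_op sF bf mq; split=> //.
have [_ [M M0 hM]] := bf.
apply: (le_integrable_fin _ (integrable_comb (M ^+ 2) 0 iq iq)) => [|t].
  exact: measurable_wrt_normX mfq.
rewrite mul0r addr0 ger0_norm ?sqr_ge0// -exprMn.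
by rewrite ler_pXn2r ?nnegrE ?mulr_ge0.
Qed.

End fixed_sigma_algebra.

Lemma sqr_integrable_sub (F F' : set (set T)) {X : normedModType R}
    (q : T -> X) :
  F `<=` F' -> sqr_integrable F q -> sqr_integrable F' q.
Proof. by move=> FF' [mq iq]; split=> // A /mq; exact: FF'. Qed.

Section orthogonality.
Context (F : set (set T)) (sF : sigma_algebra [set: T] F).
Hypothesis subF : F `<=` @measurable d T.
Context (F' : set (set T)) (sF' : sigma_algebra [set: T] F').
Hypothesis subF' : F' `<=` @measurable d T.
Hypothesis FF' : F `<=` F'.
Context (w : T -> R) (mw : measurable_wrt F' w).
Hypothesis hw : forall A, F A -> (\int[Pr]_(t in A) (w t)%:E = 0 /\
  \int[Pr]_(t in A) (w t ^+ 2)%:E = Pr A)%E.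
Context {X : hilbertType R} (sX : separable X).

Let mwT := measurable_wrt_fun sF' subF' mw.

(** The noise preserves second moments, since w^2 has conditional mean 1: this
    keeps the states of the system square integrable. *)
Lemma sqr_integrable_noise (b : T -> X) : sqr_integrable F b ->
  sqr_integrable F' (fun t => w t *: b t).
Proof.
move=> [mb ib]; have mb' : measurable_wrt F' b by move=> A /mb; exact: FF'.
have mwb := measurable_wrtZ sF' sX mw mb'; split=> //.
apply/integrableP; split.
  apply/measurable_EFinP; apply: (measurable_wrt_fun sF' subF').
  exact: measurable_wrt_normX.
under eq_integral do rewrite gee0_abs ?lee_fin ?sqr_ge0//.
under eq_integral do rewrite /= normrZ exprMn real_normK ?num_real// mulrC.
rewrite (noise_second_moment sF subF mwT hw) => [||t]; last exact: sqr_ge0.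
  by have /integrable_lty := ib; apply.
exact: measurable_wrt_normX.
Qed.

(** The cross terms are w times an F-measurable weight and integrate to 0; in
    the last term w^2 may be replaced by 1. *)
Lemma noise_energy (Q : X -> X) (a b : T -> X) : bounded_op Q ->
  sqr_integrable F a -> sqr_integrable F b ->
  \int[Pr]_t '[Q (a t + w t *: b t), a t + w t *: b t] =
  \int[Pr]_t '[Q (a t), a t] + \int[Pr]_t '[Q (b t), b t].
Proof.
move=> bQ La Lb.
have LQa := sqr_integrable_op sF subF bQ La.
have LQb := sqr_integrable_op sF subF bQ Lb.
have La' := sqr_integrable_sub FF' La.
have LQa' := sqr_integrable_sub FF' LQa.
have Lwb := sqr_integrable_noise Lb.
have LwQb := sqr_integrable_noise LQb.
have iaa := integrable_inner sF subF sX LQa La.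
have iab := integrable_inner sF' subF' sX LQa' Lwb.
have iba := integrable_inner sF' subF' sX LwQb La'.
have ibb := integrable_inner sF' subF' sX LwQb Lwb.
pose g t := '[Q (a t), b t] + '[Q (b t), a t].
have mg : measurable_wrt F g.
  apply: (measurable_wrtD sF (@separableR R)).
    exact: (measurable_wrt_inner sF sX LQa.1 Lb.1).
  exact: (measurable_wrt_inner sF sX LQb.1 La.1).
have igw : Pr.-integrable [set: T] (EFin \o (g \* w)).
  apply: eq_integrable (integrableD measurableT iab iba) => // t _ /=.
  by rewrite /g innerZl innerZr mulrDl EFinD !(mulrC (w t)).
have ibb' : Pr.-integrable [set: T]
    (EFin \o (fun t => '[Q (b t), b t] * w t ^+ 2)).
  apply: eq_integrable ibb => // t _ /=.
  by rewrite innerZl innerZr; congr EFin; ring.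
rewrite -[\int[Pr]_t '[Q (b t), b t]]add0r -(noise_mean sF subF mwT hw mg igw).
have -> : \int[Pr]_t '[Q (b t), b t] = \int[Pr]_t ('[Q (b t), b t] * w t ^+ 2).
  apply/esym/(noise_second_moment_integrable sF subF mwT hw) => //.
    exact: (measurable_wrt_inner sF sX LQb.1 Lb.1).
  exact: (integrable_inner sF subF sX LQb Lb).
rewrite addrA -RintegralD// -RintegralD//.
  apply: eq_Rintegral => t _.
  by rewrite (bop_D bQ) (bop_Z bQ) !innerE /g; ring.
apply: eq_integrable (integrableD measurableT iaa igw) => // t _ /=.
Qed.

End orthogonality.
End square_integrable.

(** * The closed-loop system *)

Section history.
Context {d : measure_display} {T : measurableType d} {R : realType}.
Context (omega : nat -> T -> R) (k : nat).

Lemma history_sigma_algebra : sigma_algebra [set: T] (history omega k).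
Proof. exact: smallest_sigma_algebra. Qed.

Lemma history_generator : history omega k =
  <<s \bigcup_(i < k) preimage_set_system [set: T] (omega i) measurable >>.
Proof.
by rewrite (bigcup_mkord k
  (fun i => preimage_set_system [set: T] (omega i) measurable)).
Qed.

Lemma measurable_history : (forall i, measurable_fun [set: T] (omega i)) ->
  history omega k `<=` measurable.
Proof.
move=> mw; rewrite history_generator; apply: smallest_sub.
  exact: sigma_algebra_measurable.
move=> A [i _ [B mB <-]]; exact: mw.
Qed.

End history.

Lemma history_succ {d : measure_display} {T : measurableType d} {R : realType}
    (omega : nat -> T -> R) k : history omega k `<=` history omega k.+1.
Proof.
rewrite !history_generator; apply: sub_sigma_algebra2.
by move=> A [i /= ik Ai]; exists i => //=; exact: ltnW.
Qed.

Lemma measurable_wrt_history {d : measure_display} {T : measurableType d}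
    {R : realType} (omega : nat -> T -> R) k :
  measurable_wrt (history omega k.+1) (omega k).
Proof.
apply/measurable_wrtP; first exact: history_sigma_algebra.
move=> O oO; rewrite history_generator; apply: sub_sigma_algebra.
exists k => //=; exists O; last by rewrite setTI.
exact: open_measurable.
Qed.

Section system.
Context {R : realType} {H U V Z : hilbertType R}.
Context (sepH : separable H) (sepV : separable V)
  (sepZ : separable Z).
Context {d : measure_display} {T : measurableType d} (Pr : probability T R).
Context (N : nat) (omega : nat -> {RV Pr >-> R}).
Context (omega_cond : nonanticipated_noise N omega).
Context (S : plant H U V Z) (gamma : R).

Local Notation F := (history omega).
Local Notation L2 k q := (sqr_integrable Pr (F k) q).
Local Notation "'Ex' f" := (\int[Pr]_t f t) (at level 10, f at level 8).

Let sF k : sigma_algebra [set: T] (F k) := history_sigma_algebra omega k.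

Let subF k : F k `<=` @measurable d T.
Proof. by apply: measurable_history => i; exact: measurable_funPT. Qed.

Lemma L2_bounded {X Y : hilbertType R} k (f : {bounded X -> Y}) q :
  L2 k q -> L2 k (fun t => f (q t)).
Proof. by apply: sqr_integrable_op => //; exact: bounded_opP. Qed.

Section stage_process.
Context (k : nat) (x : T -> H) (v : T -> V) (u : T -> U).
Hypotheses (kN : (k <= N)%N) (Lx : L2 k x) (Lv : L2 k v) (Lu : L2 k u).

Lemma L2_drift : L2 k (fun t => drift S k (x t) (v t) (u t)).
Proof.
do 2?[apply: sqr_integrableD => //]; exact: L2_bounded.
Qed.

Lemma L2_diffusion : L2 k (fun t => diffusion S k (x t) (v t) (u t)).
Proof.
do 2?[apply: sqr_integrableD => //]; exact: L2_bounded.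
Qed.

Lemma L2_output : L2 k (fun t => output S k (x t) (u t)).
Proof. by apply: sqr_integrableD => //; exact: L2_bounded. Qed.

Lemma L2_next_state :
  L2 k.+1 (fun t => next_state S k (x t) (v t) (u t) (omega k t)).
Proof.
apply: (sqr_integrableD (sF k.+1) (@subF k.+1) sepH).
  exact: sqr_integrable_sub (@history_succ _ _ _ _ k) L2_drift.
apply: sqr_integrable_noise L2_diffusion => //.
- exact: history_succ.
- exact: measurable_wrt_history.
exact: omega_cond.
Qed.

Lemma integrable_quad {X : hilbertType R} j (Q : {bounded X -> X}) q :
  separable X -> L2 j q ->
  Pr.-integrable [set: T] (EFin \o (fun t => '[Q (q t), q t])).
Proof.
by move=> sX Lq; apply: (integrable_inner (sF j)) => //; exact: L2_bounded.
Qed.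

Lemma integrable_stage_payoff P : Pr.-integrable [set: T]
  (EFin \o (fun t => stage_payoff S gamma P k (x t) (v t) (u t))).
Proof.
have i1 := integrable_quad (P k.+1) sepH L2_drift.
have i2 := integrable_quad (P k.+1) sepH L2_diffusion.
have i12 := integrable_comb 1 1 i1 i2.
have i34 := integrable_comb 1 (- gamma ^+ 2) L2_output.2 Lv.2.
apply: eq_integrable (integrable_comb 1 1 i12 i34) => // t _.
by rewrite /= /stage_payoff; congr EFin; ring.
Qed.

(** The next state is drift plus noise times diffusion with adapted drift and
    diffusion, so that noise_energy splits its quadratic payoff. *)
Lemma expected_stage_payoff (P : nat -> {bounded H -> H}) :
  let x' t := next_state S k (x t) (v t) (u t) (omega k t) in
  Ex (fun t => stage_payoff S gamma P k (x t) (v t) (u t)) =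
  Ex (fun t => '[P k.+1 (x' t), x' t])
  + Ex (fun t => `|output S k (x t) (u t)| ^+ 2)
  - gamma ^+ 2 * Ex (fun t => `|v t| ^+ 2).
Proof.
move=> x'.
have i1 := integrable_quad (P k.+1) sepH L2_drift.
have i2 := integrable_quad (P k.+1) sepH L2_diffusion.
have i12 := integrableD measurableT i1 i2.
have i3 := L2_output.2.
have i4 := integrableZl measurableT (gamma ^+ 2) Lv.2.
have i123 := integrableD measurableT i12 i3.
have -> : Ex (fun t => '[P k.+1 (x' t), x' t]) =
    Ex (fun t => '[P k.+1 (drift S k (x t) (v t) (u t)),
                   drift S k (x t) (v t) (u t)])
  + Ex (fun t => '[P k.+1 (diffusion S k (x t) (v t) (u t)),
                   diffusion S k (x t) (v t) (u t)]).
  apply: (noise_energy (sF k) (@subF k) (sF k.+1) (@subF k.+1)) => //.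
  - exact: history_succ.
  - exact: measurable_wrt_history.
  - exact: omega_cond.
  - exact: bounded_opP.
  - exact: L2_drift.
  - exact: L2_diffusion.
rewrite /stage_payoff RintegralB// RintegralD// RintegralD// RintegralZl//.
exact: Lv.2.
Qed.

End stage_process.

Lemma Rintegral_probability_cst (c : R) : Ex (fun=> c) = c.
Proof. by rewrite Rintegral_cst// [X in fine X]probability_setT mulr1. Qed.

Definition mean_square {X : hilbertType R} (q : T -> X) : R :=
  Ex (fun t => `|q t| ^+ 2).

Definition energy {X : hilbertType R} (q : nat -> T -> X) : R :=
  \sum_(k < N.+1) mean_square (q k).

Lemma mean_square_ge0 {X : hilbertType R} (q : T -> X) : 0 <= mean_square q.
Proof. by apply: Rintegral_ge0 => t _; exact: sqr_ge0. Qed.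

Lemma energy_ge0 {X : hilbertType R} (q : nat -> T -> X) : 0 <= energy q.
Proof. by apply: sumr_ge0 => k _; exact: mean_square_ge0. Qed.

Definition adapted {X : hilbertType R} (q : nat -> T -> X) : Prop :=
  forall k, (k <= N)%N -> L2 k (q k).

Lemma mean_squareE {X : hilbertType R} k (q : T -> X) : L2 k q ->
  ('E_Pr[fun t => (`|q t| ^+ 2)%R] = (mean_square q)%:E)%E.
Proof.
move=> Lq; rewrite unlock fineK//; apply: integrable_fin_num => //.
exact: Lq.2.
Qed.

Lemma L2norm_energy {X : hilbertType R} (q : nat -> T -> X) : adapted q ->
  L2norm Pr N q = (Num.sqrt (energy q))%:E.
Proof.
move=> Lq; rewrite /L2norm /energy.
have -> : (\sum_(k < N.+1) 'E_Pr[fun t => (`|q k t| ^+ 2)%R])%E =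
    (\sum_(k < N.+1) mean_square (q k))%:E.
  rewrite -sumEFin; apply: eq_bigr => k _.
  by apply: (@mean_squareE _ k); apply: Lq; rewrite -ltnS.
by [].
Qed.

Lemma L2spaceP {X : hilbertType R} (q : nat -> T -> X) :
  L2space Pr N omega q <-> adapted q.
Proof.
split=> [[mq qoo] k kN|Lq]; last first.
  split; first by move=> k /Lq[].
  by rewrite L2norm_energy// ltry.
split; first exact: mq.
have mk : measurable_fun [set: T] (fun t => `|q k t| ^+ 2).
  by apply: (measurable_wrt_fun (sF k) (@subF k)); apply: measurable_wrt_normX;
    [exact: sF|exact: mq].
apply/integrableP; split; first exact/measurable_EFinP.
under eq_integral do rewrite gee0_abs ?lee_fin ?sqr_ge0//.
have E0 j : (0 <= 'E_Pr[fun t => (`|q j t| ^+ 2)%R])%E.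
  by rewrite unlock integral_ge0// => t _; rewrite lee_fin sqr_ge0.
rewrite -/(expectation.body Pr _).
have : (\sum_(j < N.+1) 'E_Pr[fun t => (`|q j t| ^+ 2)%R] < +oo)%E.
  move: qoo; rewrite /L2norm; set s := (\sum_(j < N.+1) _)%E.
  by case: s => //= r _; rewrite ltry.
apply: le_lt_trans.
rewrite (bigD1 (Ordinal (kN : (k < N.+1)%N)))//= unlock leeDl// sume_ge0//.
move=> j _.
by have := E0 j; rewrite unlock.
Qed.

Section closed_loop.
Context (K : nat -> {bounded H -> U}) (v : nat -> T -> V).
Hypothesis Lv : adapted v.
Local Notation x := (cl_state S omega K v).

Lemma L2_cl_state k : (k <= N.+1)%N -> L2 k (x k).
Proof.
elim: k => [_|k IH kN]; first exact: sqr_integrable_cst.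
by apply: L2_next_state => //; [apply: IH; exact: ltnW|exact: Lv|];
  apply: L2_bounded; apply: IH; exact: ltnW.
Qed.

Lemma adapted_cl_output : adapted (cl_output S omega K v).
Proof.
move=> k kN; have Lx := L2_cl_state (leqW kN).
by apply: L2_output => //; exact: L2_bounded.
Qed.

(** The values <P x, x> telescope: they vanish at time 0, where x = 0, and at
    time N + 1, where P = 0. *)
Lemma total_payoff (P : nat -> {bounded H -> H}) : P N.+1 =1 (fun=> 0) ->
  energy (cl_output S omega K v) - gamma ^+ 2 * energy v =
  \sum_(k < N.+1)
    Ex (fun t => stage_payoff S gamma P k (x k t) (v k t) (K k (x k t))
                 - '[P k (x k t), x k t]).
Proof.
move=> PN.
pose a k := Ex (fun t => '[P k (x k t), x k t]).
have aN : a N.+1 = 0.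
  rewrite /a; under eq_Rintegral do rewrite PN inner0l.
  by rewrite /Rintegral integral0.
have a0 : a 0%N = 0.
  rewrite /a; under eq_Rintegral do rewrite inner0r.
  by rewrite /Rintegral integral0.
have := telescope_sumr a (leq0n N.+1); rewrite aN a0 subrr big_mkord => tele.
rewrite -[LHS]add0r -[X in X + _]tele /energy mulr_sumr -sumrB -big_split/=.
apply: eq_bigr => -[k kN] _ /=; rewrite ltnS in kN.
have Lx := L2_cl_state (leqW kN).
have Lu := L2_bounded (K k) Lx.
rewrite RintegralB//; last exact: (integrable_quad (P k) sepH Lx).
  rewrite expected_stage_payoff//; last exact: Lv.
  by rewrite /a/= /mean_square /cl_output; ring.
by apply: integrable_stage_payoff => //; exact: Lv.
Qed.

End closed_loop.

Lemma mean_square_le {X Y W : hilbertType R} k (M : R) (q : T -> X)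
    (a : T -> Y) (b : T -> W) : L2 k q -> L2 k a -> L2 k b ->
  (forall t, `|q t| ^+ 2 <= M * (`|a t| ^+ 2 + `|b t| ^+ 2)) ->
  mean_square q <= M * (mean_square a + mean_square b).
Proof.
move=> [_ iq] [_ ia] [_ ib] qab.
have iab : Pr.-integrable [set: T]
    (EFin \o (fun t => `|a t| ^+ 2 + `|b t| ^+ 2)).
  exact: (integrableD measurableT ia ib).
rewrite /mean_square -RintegralD// -RintegralZl//; apply: le_Rintegral => //.
exact: (integrableZl measurableT M iab).
Qed.

Lemma mean_square_next_state k x v u : (k <= N)%N -> L2 k x -> L2 k v ->
  L2 k u ->
  mean_square (fun t => next_state S k (x t) (v t) (u t) (omega k t)) =
  mean_square (fun t => drift S k (x t) (v t) (u t))
  + mean_square (fun t => diffusion S k (x t) (v t) (u t)).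
Proof.
move=> kN Lx Lv Lu; rewrite /mean_square.
under eq_Rintegral do rewrite -inner_norm.
under [in RHS]eq_Rintegral do rewrite -inner_norm.
under [X in _ = _ + X]eq_Rintegral do rewrite -inner_norm.
apply: (noise_energy (sF k) (@subF k) (sF k.+1) (@subF k.+1) _ _ _ sepH
  (Q := idfun)).
- exact: history_succ.
- exact: measurable_wrt_history.
- exact: omega_cond.
- exact: bounded_op_id.
- exact: L2_drift.
- exact: L2_diffusion.
Qed.

Lemma mean_square_le_energy {X : hilbertType R} (q : nat -> T -> X) k :
  (k <= N)%N -> mean_square (q k) <= energy q.
Proof.
move=> kN; rewrite /energy (bigD1 (Ordinal (kN : (k < N.+1)%N)))//= lerDl.
by apply: sumr_ge0 => j _; exact: mean_square_ge0.
Qed.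

(** * Solutions of the Riccati equation give the gain bound *)

Section deviation.
Context (K1 : nat -> {bounded H -> V}) (K2 : nat -> {bounded H -> U}).
Local Notation x := (cl_state S omega K2).

(** How far the disturbance is from the worst-case feedback. *)
Definition deviation (v : nat -> T -> V) (k : nat) (t : T) : V :=
  v k t - K1 k (x v k t).

Lemma L2_deviation v k : adapted v -> (k <= N)%N -> L2 k (deviation v k).
Proof.
move=> Lv kN; have Lx := L2_cl_state K2 Lv (leqW kN).
have bNK1 := bounded_opN (bounded_opP (K1 k)).
have L1 := sqr_integrable_op (sF k) (@subF k) bNK1 Lx.
by apply: (sqr_integrableD _ _ _ (Lv _ kN) L1).
Qed.

(** Once v is written as K1 x plus the deviation, the state obeys a linear
    recursion driven by the deviation alone. *)
Lemma state_le_deviation k : (k <= N.+1)%N ->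
  exists2 c, 0 <= c & forall v, adapted v ->
    mean_square (x v k) <= c * energy (deviation v).
Proof.
elim: k => [_|k IH kN].
  exists 0 => // v _; rewrite mul0r /mean_square.
  under eq_Rintegral do rewrite normr0 expr0n.
  by rewrite /Rintegral integral0.
have [c c0 hc] := IH (ltnW kN).
have bK1 := bounded_opP (K1 k); have bK2 := bounded_opP (K2 k).
have bound (A : {bounded H -> H}) (B1 : {bounded V -> H})
    (B2 : {bounded U -> H}) :
    exists2 M, 0 <= M & forall y h,
    `|A y + B1 (h + K1 k y) + B2 (K2 k y)| ^+ 2 <= M * (`|y| ^+ 2 + `|h| ^+ 2).
  have b1 := bounded_opP B1.
  have bACL : bounded_op (A \+ (B1 \o K1 k) \+ (B2 \o K2 k)).
    apply: bounded_opD; last first.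
      by apply: bounded_op_comp => //; exact: bounded_opP.
    by apply: bounded_opD; [exact: bounded_opP|exact: bounded_op_comp].
  have [M M0 hM] := bounded_op_sum_sqr bACL b1.
  exists M => // y h; have := hM y h; congr (`|_| ^+ 2 <= _) => /=.
  by rewrite (bop_D b1) (addrC (B1 h)) addrA [RHS]addrAC.
have [M M0 hM] := bound (opA S k) (opB1 S k) (opB2 S k).
have [L L0 hL] := bound (opC S k) (opD1 S k) (opD2 S k).
exists ((M + L) * (c + 1)) => [|v Lv].
  by rewrite mulr_ge0 ?addr_ge0.
have kN' : (k <= N)%N by [].
have Lx := L2_cl_state K2 Lv (leqW kN').
have Lvk := Lv _ kN'.
have Lu := L2_bounded (K2 k) Lx.
have Lh := L2_deviation Lv kN'.
rewrite mean_square_next_state//.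
have h1 : mean_square (fun t => drift S k (x v k t) (v k t) (K2 k (x v k t))) <=
    M * (mean_square (x v k) + mean_square (deviation v k)).
  apply: (@mean_square_le _ _ _ k) => //; first exact: L2_drift.
  move=> t; have := hM (x v k t) (deviation v k t).
  by rewrite /deviation subrK.
have h2 :
    mean_square (fun t => diffusion S k (x v k t) (v k t) (K2 k (x v k t))) <=
    L * (mean_square (x v k) + mean_square (deviation v k)).
  apply: (@mean_square_le _ _ _ k) => //; first exact: L2_diffusion.
  move=> t; have := hL (x v k t) (deviation v k t).
  by rewrite /deviation subrK.
apply: le_trans (lerD h1 h2) _; rewrite -mulrDl -mulrA ler_wpM2l ?addr_ge0//.
rewrite mulrDl mul1r lerD ?hc//; exact: mean_square_le_energy.
Qed.

Lemma disturbance_le_deviation : exists2 c, 0 < c & forall v, adapted v ->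
  energy v <= c * energy (deviation v).
Proof.
suff : forall n, (n <= N.+1)%N -> exists2 c, 0 < c & forall v, adapted v ->
    \sum_(k < n) mean_square (v k) <= c * energy (deviation v) by exact.
elim=> [_|k IH kN].
  by exists 1 => // v _; rewrite big_ord0 mul1r energy_ge0.
have [c c0 hc] := IH (ltnW kN).
have [a a0 ha] := state_le_deviation (ltnW kN).
have [M M0 hM] := bounded_op_sum_sqr (bounded_opP (K1 k)) bounded_op_id.
exists (c + M * (a + 1)) => [|v Lv].
  by rewrite ltr_wpDr// mulr_ge0// addr_ge0.
have kN' : (k <= N)%N by [].
have Lx := L2_cl_state K2 Lv (leqW kN').
have Lh := L2_deviation Lv kN'.
rewrite big_ord_recr/= mulrDl lerD ?hc//.
have h1 : mean_square (v k) <=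
    M * (mean_square (x v k) + mean_square (deviation v k)).
  apply: (@mean_square_le _ _ _ k) => //; first exact: Lv.
  move=> t; have := hM (x v k t) (deviation v k t).
  by rewrite /deviation/= subrKC.
apply: le_trans h1 _; rewrite -mulrA ler_wpM2l//.
rewrite mulrDl mul1r lerD ?ha//; exact: mean_square_le_energy.
Qed.

End deviation.

Hypothesis GC0 : forall k, (k <= N)%N ->
  adj (opGbar S k) \o opCbar S k =1 (fun=> 0).
Hypothesis GG1 : forall k, (k <= N)%N ->
  adj (opGbar S k) \o opGbar S k =1 idfun.
Hypothesis gamma_gt0 : 0 < gamma.

Lemma uniform_coercive P K1 K2 : riccati_solution S gamma N P K1 K2 ->
  exists2 theta, 0 < theta &
    forall k, (k <= N)%N -> coercive theta (calR1 S gamma P k).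
Proof.
move=> [_ _ st].
suff : forall n, (n <= N.+1)%N -> exists2 theta, 0 < theta &
    forall k, (k < n)%N -> coercive theta (calR1 S gamma P k).
  by move/(_ _ (leqnn _)).
elim=> [_|n IH nN]; first by exists 1.
have [theta th0 hth] := IH (ltnW nN).
have [_ _ pR1 _ _] := st n nN.
have /(op_gt0P (bounded_calR1 S gamma P n))[_ [rho rho0 hrho]] := pR1.
exists (Num.min theta rho) => [|k]; first by rewrite lt_min th0.
rewrite ltnS leq_eqVlt => /orP[/eqP->|kn] h.
  by apply: le_trans (hrho h); rewrite ler_wpM2r ?sqr_ge0// ge_min lexx orbT.
by apply: le_trans (hth _ kn h); rewrite ler_wpM2r ?sqr_ge0// ge_min lexx.
Qed.

(** Completing the square in the disturbance turns the payoff into minus the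
    R1-energy of the deviation. Since the deviation controls the disturbance,
    a fixed fraction of the energy of v is lost. *)
Lemma riccati_gain_lt P K1 K2 : riccati_solution S gamma N P K1 K2 ->
  exists2 eps, 0 < eps & forall v, adapted v ->
    energy (cl_output S omega K2 v) <= (gamma ^+ 2 - eps) * energy v.
Proof.
move=> sol; have [theta th0 hth] := uniform_coercive sol.
have [c c0 hc] := disturbance_le_deviation K1 K2.
have [sP PN st] := sol.
exists (theta / c) => [|v Lv]; first exact: divr_gt0.
have := total_payoff K2 Lv PN.
have : \sum_(k < N.+1) Ex (fun t =>
      stage_payoff S gamma P k (cl_state S omega K2 v k t) (v k t)
        (K2 k (cl_state S omega K2 v k t))
      - '[P k (cl_state S omega K2 v k t), cl_state S omega K2 v k t]) <=
    - theta * energy (deviation K1 K2 v).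
  rewrite /energy mulr_sumr; apply: ler_sum => -[k kN] _ /=.
  rewrite ltnS in kN.
  have Lx := L2_cl_state K2 Lv (leqW kN).
  have Lu := L2_bounded (K2 k) Lx.
  have Lh := L2_deviation K1 K2 Lv kN.
  have Lvk := Lv _ kN.
  rewrite -RintegralZl//; last exact: Lh.2.
  apply: le_Rintegral => //.
  - exact: (integrableB measurableT (integrable_stage_payoff Lx Lvk Lu P)
      (integrable_quad (P k) sepH Lx)).
  - exact: (integrableZl measurableT _ Lh.2).
  move=> t _.
  have stk : riccati_stage S gamma P K1 K2 k by exact: st.
  have [_ _ pR1 _ PE] := st k kN.
  have sPk : symmetric_op (P k.+1).
    by apply/(self_adjointP (bounded_opP _)); exact: sP.
  rewrite (payoff_disturbance sPk (GC0 kN) (GG1 kN) (riccati_stage_K1 stk)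
    pR1 PE).
  by rewrite addrAC subrr add0r mulNr lerN2; exact: hth.
move=> h1 h2; have := hc v Lv; move: h1; rewrite -h2.
set ez := energy _; set ev := energy v; set ed := energy (deviation _ _ _).
move=> h3 h4; have : theta / c * ev <= theta / c * (c * ed).
  by rewrite ler_wpM2l// divr_ge0// ltW.
rewrite [X in _ <= X](_ : _ = theta * ed); last by field; rewrite gt_eqF.
by rewrite mulrBl; lra.
Qed.

(** The gain is bounded away from gamma uniformly in the disturbance, so the
    inequality stays strict in the supremum. *)
Lemma Hinf_norm_lt (K : nat -> {bounded H -> U}) (eps : R) : 0 < eps ->
  (forall v, adapted v ->
    energy (cl_output S omega K v) <= (gamma ^+ 2 - eps) * energy v) ->
  (Hinf_norm Pr N S omega K < gamma%:E)%E.
Proof.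
move=> eps0 hK.
apply: (@le_lt_trans _ _ (Num.sqrt (gamma ^+ 2 - eps))%:E); last first.
  rewrite lte_fin -[ltRHS]ger0_norm ?(ltW gamma_gt0)// -sqrtr_sqr.
  by rewrite ltr_sqrt ?exprn_gt0// ltrBlDr ltrDl.
apply: ub_ereal_sup => _ [v [/L2spaceP Lv v0] <-].
move: v0; rewrite /= !L2norm_energy//; last exact: adapted_cl_output.
move=> v0.
have {}v0 : 0 < Num.sqrt (energy v).
  by rewrite lt_neqAle sqrtr_ge0 andbT eq_sym;
    apply: contra v0 => /eqP ->.
rewrite inver gt_eqF// -EFinM lee_fin ler_pdivrMr//.
have ev : 0 < energy v by rewrite sqrtr_gt0 in v0.
have ge : 0 <= gamma ^+ 2 - eps.
  rewrite -(pmulr_lge0 _ ev); apply: le_trans (hK _ Lv); exact: energy_ge0.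
rewrite -sqrtrM// ler_wsqrtr//; exact: hK.
Qed.

Lemma Hinf_norm_gain (K : nat -> {bounded H -> U}) :
  (Hinf_norm Pr N S omega K < gamma%:E)%E ->
  exists2 eps, 0 < eps & forall v, adapted v ->
    0 < energy v ->
    energy (cl_output S omega K v) <= (gamma ^+ 2 - eps) * energy v.
Proof.
move=> hK.
have [r [r0 rg hr]] : exists r, [/\ 0 <= r, r < gamma
    & (Hinf_norm Pr N S omega K <= r%:E)%E].
  move: hK; case: (Hinf_norm _ _ _ _ _) => [r||]//.
    rewrite lte_fin => rg; exists (Num.max 0 r).
    by rewrite le_max lexx gt_max gamma_gt0 rg lee_fin le_max lexx orbT.
  by exists 0; rewrite lexx leNye.
exists (gamma ^+ 2 - r ^+ 2) => [|v Lv ev].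
  by rewrite subr_gt0 ltr_pXn2r ?nnegrE// ltW.
rewrite subKr.
have sv : 0 < Num.sqrt (energy v) by rewrite sqrtr_gt0.
have : (L2norm Pr N (cl_output S omega K v) / L2norm Pr N v <= r%:E)%E.
  apply: le_trans hr; apply: ereal_sup_ubound; exists v => //; split.
    exact/L2spaceP.
  by rewrite /= L2norm_energy// eqe gt_eqF.
rewrite !L2norm_energy//; last exact: adapted_cl_output.
rewrite inver gt_eqF// -EFinM lee_fin ler_pdivrMr// => h.
have := @ler_pXn2r R 2 isT (Num.sqrt (energy (cl_output S omega K v)))
  (r * Num.sqrt (energy v)).
rewrite !nnegrE sqrtr_ge0 mulr_ge0 ?sqrtr_ge0// => /(_ isT isT).
by rewrite h exprMn !sqr_sqrtr ?energy_ge0// => ->.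
Qed.

(** * The gain bound gives a solution of the Riccati equation *)

Section state_feedback_disturbance.
Context (K : nat -> {bounded H -> U}) (w : nat -> H -> V).

(** The closed loop in which the disturbance too is a function of the state.
    Such a disturbance depends on the trajectory that it generates, hence this
    separate recursion. *)
Fixpoint feedback_state (k : nat) (t : T) : H :=
  if k is j.+1 then
    let y := feedback_state j t in next_state S j y (w j y) (K j y) (omega j t)
  else 0.

Definition feedback_disturbance (k : nat) (t : T) : V :=
  w k (feedback_state k t).

Lemma cl_state_feedback k :
  cl_state S omega K feedback_disturbance k = feedback_state k.
Proof.
by elim: k => [//|k IH]; apply/funext => t /=; rewrite IH.
Qed.

Hypothesis Lw : forall k q, (k <= N)%N -> L2 k q -> L2 k (fun t => w k (q t)).

Lemma adapted_feedback_disturbance : adapted feedback_disturbance.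
Proof.
have Ly k : (k <= N.+1)%N -> L2 k (feedback_state k).
  elim: k => [_|k IH kN]; first exact: sqr_integrable_cst.
  have Lk := IH (ltnW kN).
  by apply: L2_next_state => //; [exact: Lw|exact: L2_bounded].
by move=> k kN; apply: Lw => //; apply: Ly; exact: leqW.
Qed.

End state_feedback_disturbance.

Section worst_case.
Context (K : nat -> {bounded H -> U}) (eps : R).
Hypothesis eps_gt0 : 0 < eps.
Hypothesis gainK : forall v, adapted v -> 0 < energy v ->
  energy (cl_output S omega K v) <= (gamma ^+ 2 - eps) * energy v.
Context (P : nat -> {bounded H -> H}) (K1 : nat -> {bounded H -> V})
  (K2 : nat -> {bounded H -> U}) (k : nat).
Hypothesis kN : (k <= N)%N.
Hypothesis sP : forall j, symmetric_op (P j).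
Hypothesis PN : P N.+1 =1 (fun=> 0).
Hypothesis st : forall j, (k < j <= N)%N -> riccati_stage S gamma P K1 K2 j.

(** The test disturbance vanishes before time k, so that the state stays at 0,
    is the constant v0 at time k, and is the feedback K1 x afterwards. By
    payoff_control each later stage pays at least the decrease of <P x, x>,
    whatever the control; stage k itself leaves -<R1 v0, v0>. The gain bound
    makes the total at most -eps |v0|^2. *)
Lemma coercive_calR1 : coercive eps (calR1 S gamma P k).
Proof.
move=> v0; have [->|v00] := eqVneq v0 0.
  by rewrite normr0 expr0n mulr0 inner0r.
pose w j (y : H) : V :=
  if (j < k)%N then 0 else if j == k then v0 else K1 j y.
pose v := feedback_disturbance K w.
have Lw j q : (j <= N)%N -> L2 j q -> L2 j (fun t => w j (q t)).
  move=> jN Lq; rewrite /w; case: (j < k)%N; first exact: sqr_integrable_cst.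
  by case: (j == k); [exact: sqr_integrable_cst|exact: L2_bounded].
have Lv : adapted v := adapted_feedback_disturbance K Lw.
pose x := feedback_state K w.
have xE j : cl_state S omega K v j = x j by exact: cl_state_feedback.
have x0 j t : (j <= k)%N -> x j t = 0.
  elim: j => [//|j IH jk]; rewrite /x /= -/x IH 1?ltnW// /w jk.
  by rewrite /next_state !(bop_0 (bounded_opP _)) !addr0 scaler0 addr0.
have vk t : v k t = v0 by rewrite /v /feedback_disturbance /w ltnn eqxx.
have vk2 : mean_square (v k) = `|v0| ^+ 2.
  rewrite /mean_square; under eq_Rintegral do rewrite vk.
  exact: Rintegral_probability_cst.
have ev : `|v0| ^+ 2 <= energy v by rewrite -vk2; exact: mean_square_le_energy.
have v02 : 0 < `|v0| ^+ 2 by rewrite exprn_gt0// normr_gt0.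
have := gainK Lv (lt_le_trans v02 ev).
move=> gain.
have := total_payoff K Lv PN.
suff : - '[calR1 S gamma P k v0, v0] <= \sum_(j < N.+1)
    Ex (fun t => stage_payoff S gamma P j (cl_state S omega K v j t) (v j t)
        (K j (cl_state S omega K v j t))
      - '[P j (cl_state S omega K v j t), cl_state S omega K v j t]).
  move=> h1 h2; move: h1; rewrite -h2 => h1.
  have : eps * `|v0| ^+ 2 <= eps * energy v by rewrite ler_wpM2l// ltW.
  by move: gain h1; rewrite mulrBl; lra.
rewrite (bigD1 (Ordinal (kN : (k < N.+1)%N)))//=.
have -> : Ex (fun t => stage_payoff S gamma P k (cl_state S omega K v k t)
    (v k t) (K k (cl_state S omega K v k t))
    - '[P k (cl_state S omega K v k t), cl_state S omega K v k t]) =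
    - '[calR1 S gamma P k v0, v0].
  under eq_Rintegral do rewrite xE x0// vk.
  rewrite Rintegral_probability_cst inner0r subr0.
  rewrite inner_calR1 /stage_payoff /drift /diffusion /output.
  rewrite !(bop_0 (bounded_opP _)) !add0r !addr0 normr0 expr0n inner_norm /=.
  ring.
rewrite lerDl; apply: sumr_ge0 => -[j jN] /=.
rewrite -val_eqE /= => jk; rewrite ltnS in jN.
apply: Rintegral_ge0 => t _; rewrite xE subr_ge0.
have [{}jk|kj] : (j < k)%N \/ (k < j)%N.
  by apply/orP; rewrite -neq_ltn.
  rewrite x0 ?(ltnW jk)// inner0r /v /feedback_disturbance /w jk.
  rewrite /stage_payoff /drift /diffusion /output !(bop_0 (bounded_opP _)).
  by rewrite !addr0 normr0 expr0n /= !inner0r mulr0 subr0 !addr0.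
have stj : riccati_stage S gamma P K1 K2 j by apply: st; rewrite kj.
have -> : v j t = K1 j (x j t).
  by rewrite /v /feedback_disturbance /w ltnNge (ltnW kj)/= gtn_eqF.
have [_ _ pR1 pR2 PE] := stj.
rewrite (payoff_control (sP j.+1) (GC0 jN) (GG1 jN) (riccati_stage_K1 stj)
  (riccati_stage_K2 stj) pR1 PE) lerDl.
have /(op_gt0P (bounded_calR2 S P j))[_ [theta th0 cR2]] := pR2.
by apply: le_trans (cR2 _); rewrite mulr_ge0 ?exprn_ge0// ltW.
Qed.

End worst_case.

Lemma riccati_stage_ext P P' K1 K1' K2 K2' k : P' k = P k ->
  P' k.+1 = P k.+1 -> K1' k = K1 k -> K2' k = K2 k ->
  riccati_stage S gamma P K1 K2 k -> riccati_stage S gamma P' K1' K2' k.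
Proof.
move=> e0 e1 e2 e3; rewrite /riccati_stage /riccati_rhs /calR1 /calR2 /calG1.
by rewrite /calG2 e0 e1 e2 e3.
Qed.

(** Backward induction: once the stages after k are solved, the test disturbance
    shows R1(k) > 0, and this is what riccati_step needs to solve stage k. *)
Lemma riccati_solution_exists (K : nat -> {bounded H -> U}) :
  (Hinf_norm Pr N S omega K < gamma%:E)%E ->
  exists P K1 K2, riccati_solution S gamma N P K1 K2.
Proof.
move=> /Hinf_norm_gain[eps eps0 gainK].
have [zH zHE] := bounded_op_pack (@bounded_op_cst0 _ H H).
have [zV _] := bounded_op_pack (@bounded_op_cst0 _ H V).
have [zU _] := bounded_op_pack (@bounded_op_cst0 _ H U).
(* After m steps the last m of the times 0, ..., N are solved. *)
suff back m : (m <= N.+1)%N -> exists (P : nat -> {bounded H -> H})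
    (K1 : nat -> {bounded H -> V}) (K2 : nat -> {bounded H -> U}),
    [/\ forall j, symmetric_op (P j), forall j x, 0 <= '[P j x, x],
      P N.+1 =1 (fun=> 0)
    & forall j, (N < j + m)%N -> (j <= N)%N ->
        riccati_stage S gamma P K1 K2 j].
  have [P [K1 [K2 [sP _ PN st]]]] := back _ (leqnn N.+1).
  exists P, K1, K2; split => // k kN.
    by apply/(self_adjointP (bounded_opP _)); exact: sP.
  by apply: st => //; rewrite addnS ltnS leq_addl.
elim: m => [_|m IH mN].
  exists (fun=> zH), (fun=> zV), (fun=> zU); split.
  - by move=> j x y; rewrite zHE inner0l inner0r.
  - by move=> j x; rewrite zHE inner0l.
  - by move=> x; rewrite zHE.
  by move=> j; rewrite addn0 => h1 h2; move: (leq_trans h1 h2); rewrite ltnn.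
have [P [K1 [K2 [sP P0 PN st]]]] := IH (ltnW mN).
pose k := (N - m)%N.
have mN' : (m <= N)%N by [].
have kN : (k <= N)%N by exact: leq_subr.
have kE : (k + m)%N = N by exact: subnK.
have pR1 : op_gt0 (calR1 S gamma P k).
  apply/(op_gt0P (bounded_calR1 S gamma P k)); split.
    exact: symmetric_calR1.
  exists eps => //.
  apply: (coercive_calR1 eps0 gainK kN sP PN (K1 := K1) (K2 := K2)).
  by move=> j /andP[kj jN]; apply: st => //; rewrite -kE ltn_add2r.
have [p [k1 [k2 [sp p0 stk]]]] :=
  riccati_step (GC0 kN) (GG1 kN) (sP k.+1) (P0 k.+1) pR1.
exists (fun j => if j == k then p else P j),
  (fun j => if j == k then k1 else K1 j),
  (fun j => if j == k then k2 else K2 j); split.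
- by move=> j; case: ifP.
- by move=> j; case: ifP.
- by rewrite gtn_eqF.
move=> j; rewrite addnS ltnS -{1}kE leq_add2r leq_eqVlt => /orP[/eqP<-|kj] jN.
  by apply: stk; rewrite ?eqxx// gtn_eqF.
apply: (riccati_stage_ext _ _ _ _ (st j _ jN)).
- by rewrite gtn_eqF.
- by rewrite gtn_eqF// ltnW.
- by rewrite gtn_eqF.
- by rewrite gtn_eqF.
by rewrite -kE ltn_add2r.
Qed.

End system.

Theorem theorem5 (R : realType) (H U V Z : hilbertType R)
  (sepH : separable H) (sepU : separable U) (sepV : separable V)
  (sepZ : separable Z)
  (d : measure_display) (T : measurableType d) (Pr : probability T R)
  (N : nat) (omega : nat -> {RV Pr >-> R})
  (omega_moments : orthonormal_noise N omega)
  (omega_cond : nonanticipated_noise N omega)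
  (S : plant H U V Z)
  (GC0 : forall k, (k <= N)%N -> adj (opGbar S k) \o opCbar S k =1 (fun=> 0))
  (GG1 : forall k, (k <= N)%N -> adj (opGbar S k) \o opGbar S k =1 idfun)
  (gamma : R) (gamma_gt0 : 0 < gamma) :
  ((exists K : nat -> {bounded H -> U},
      (Hinf_norm Pr N S omega K < gamma%:E)%E)
   <->
   (exists (P : nat -> {bounded H -> H}) (K1 : nat -> {bounded H -> V})
           (K2 : nat -> {bounded H -> U}),
      riccati_solution S gamma N P K1 K2))
  /\
  (forall (P : nat -> {bounded H -> H}) (K1 : nat -> {bounded H -> V})
          (K2 : nat -> {bounded H -> U}),
     riccati_solution S gamma N P K1 K2 ->
     (Hinf_norm Pr N S omega K2 < gamma%:E)%E).
Proof.
have sufficiency P K1 K2 : riccati_solution S gamma N P K1 K2 ->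
    (Hinf_norm Pr N S omega K2 < gamma%:E)%E.
  move=> sol.
  have [eps eps0 gain] := riccati_gain_lt sepH sepV sepZ omega_cond GC0 GG1 sol.
  exact: (Hinf_norm_lt sepH sepZ omega_cond gamma_gt0 eps0 gain).
split=> //; split=> [[K hK]|[P [K1 [K2 sol]]]].
  exact: (riccati_solution_exists sepH sepZ omega_cond GC0 GG1
    gamma_gt0 hK).
by exists K2; exact: sufficiency sol.
Qed.
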